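(* Let $\sigma$ be a germ of holomorphic map of $(\mathbb C^{2p},0)$, with coordinates $(\xi,\eta)$, $\sigma(0)=0$, whose linear part at $0$ is $\hat S\colon\xi_j'=\mu_j\xi_j,\ \eta_j'=\mu_j^{-1}\eta_j$ $(1\le j\le p)$. Assume that $\mu_1,\dots,\mu_p$ are non-resonant. Suppose that $\sigma=\tau_1\tau_2$, where $\tau_1$ is a holomorphic involution, $\rho$ is an anti-holomorphic involution (both fixing $0$), and $\tau_2=\rho\tau_1\rho$. Then there exists a formal (invertible) map $\Psi$ such that $\Psi^{-1}\rho\Psi$ (still denoted $\rho$) is the standard anti-holomorphic involution described in the context, and $\sigma^*=\Psi^{-1}\sigma\Psi$ and $\tau_i^*=\Psi^{-1}\tau_i\Psi$ have the form $$\sigma^*\colon\ \xi_j'=M_j(\xi\eta)\xi_j,\quad \eta_j'=M_j^{-1}(\xi\eta)\eta_j,\qquad \tau_i^*\colon\ \xi_j'=\Lambda_{ij}(\xi\eta)\eta_j,\quad\eta_j'=\Lambda_{ij}^{-1}(\xi\eta)\xi_j,\qquad 1\le j\le p,$$ where $\xi\eta=(\xi_1\eta_1,\dots,\xi_p\eta_p)$ and $M_j,\Lambda_{ij}$ are formal power series in $p$ variables. Assume further that $\log M$ is tangent to the identity. Then, under a further formal change of coordinates that preserves $\rho$, $\sigma^*$ and $\tau_i^*$ are transformed into $$\hat\sigma\colon\ \xi_j'=\hat M_j(\xi\eta)\xi_j,\quad \eta_j'=\hat M_j^{-1}(\xi\eta)\eta_j,\qquad \hat\tau_i\colon\ \xi_j'=\hat\Lambda_{ij}(\xi\eta)\eta_j,\quad\eta_j'=\hat\Lambda_{ij}^{-1}(\xi\eta)\xi_j,\qquad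 \hat\Lambda_{2j}=\hat\Lambda_{1j}^{-1},$$ where $\log\hat M$ is tangent to the identity and, for each $j$, the $j$th component of $\log\hat M(\zeta)-\zeta$ is independent of $\zeta_j$. Moreover, $\hat M=(\hat M_1,\dots,\hat M_p)$ is unique.
   Context: Fix integers $e_*,h_*,s_*\ge0$ with $e_*+h_*+2s_*=p$; indices range as $1\le e\le e_*$, $e_*<h\le e_*+h_*$, $e_*+h_*<s\le p-s_*$. The eigenvalues satisfy the normalization $\mu_j=\lambda_j^2$ with $\lambda_e>1$; $|\lambda_h|=1$, $\arg\lambda_h\in(0,\pi/2)$; $|\lambda_s|>1$, $\arg\lambda_s\in(0,\pi/2)$; $\lambda_{s+s_*}=\bar\lambda_s^{-1}$. Non-resonant means $\mu^Q\ne1$ for all $Q\in\mathbb Z^p\setminus\{0\}$. The standard anti-holomorphic involution is $$\rho\colon\ \xi_e'=\bar\eta_e,\ \eta_e'=\bar\xi_e;\quad \xi_h'=\bar\xi_h,\ \eta_h'=\bar\eta_h;\quad \xi_s'=\bar\xi_{s+s_*},\ \eta_s'=\bar\eta_{s+s_*},\ \xi_{s+s_*}'=\bar\xi_s,\ \eta_{s+s_*}'=\bar\eta_s.$$ For $M=(M_1,\dots,M_p)$ with $M_j(0)\ne0$, $\log M$ is the formal map of $\mathbb C^p$ with components $(\log M)_j(\zeta)=\log(M_j(\zeta)/M_j(0))$ for $1\le j\le e_*$ and $(\log M)_j(\zeta)=-i\log(M_j(\zeta)/M_j(0))$ for $e_*<j\le p$. It is tangent to the identity if $\log M(\zeta)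=\zeta+O(|\zeta|^2)$.
   Formalization: Uniqueness of M̂ is asserted among normal forms with M̂(0)=M(0), i.e. with the labelled eigenvalues kept; without this, exchanging two elliptic coordinate pairs preserves ρ and all the forms but permutes the components of M̂. *)

(* Defs.v *)
From mathcomp Require Import all_boot all_order all_algebra.
From mathcomp Require Import reals complex mpoly.
From mathcomp Require trigo.

Set Implicit Arguments.
Unset Strict Implicit.
Unset Printing Implicit Defensive.

Import Order.TTheory GRing.Theory Num.Theory.

Local Open Scope ring_scope.
Local Open Scope complex_scope.

Section FormalSeries.

Variable R : realType.
Local Notation C := R[i].

(* Formal power series over C in n variables, as coefficient families. *)
Definition fps (n : nat) : Type := 'X_{1..n} -> C.

Definition pstrunc n (d : nat) (f : fps n) : {mpoly C[n]} :=
  \sum_(m : 'X_{1..n < d.+1}) f m *: 'X_[m].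

Definition psconst n (c : C) : fps n := fun m => c *+ (m == 0%MM).
Definition psX n (i : 'I_n) : fps n := fun m => (m == U_(i)%MM)%:R.
Definition pssub n (f g : fps n) : fps n := fun m => f m - g m.
Definition psscale n (c : C) (f : fps n) : fps n := fun m => c * f m.

(* The coefficient of a product at m only depends on the terms of degree at
   most mdeg m of the factors. *)
Definition psmul n (f g : fps n) : fps n :=
  fun m => (pstrunc (mdeg m) f * pstrunc (mdeg m) g)@_m.

(* f(G_1, ..., G_k). This is the substitution of formal power series provided
   that every G_i has zero constant term: the coefficient at m then only
   depends on the terms of degree at most mdeg m of f and of the G_i.
   Otherwise the value is meaningless. *)
Definition pscomp k n (f : fps k) (G : 'I_k -> fps n) : fps n :=
  fun m => (pstrunc (mdeg m) f \mPo
            [tuple pstrunc (mdeg m) (G i) | i < k])@_m.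

(* f / f(0) - 1 *)
Definition psnormalize n (f : fps n) : fps n :=
  pssub (psscale (f 0%MM)^-1 f) (@psconst n 1).

(* 1/f = f(0)^-1 * 1/(1 + u), u = f / f(0) - 1, when f(0) != 0. *)
Definition psinv n (f : fps n) : fps n :=
  let geom : fps 1 := fun m => (-1) ^+ m ord0 in
  psscale (f 0%MM)^-1 (pscomp geom (fun _ => psnormalize f)).

(* log (f / f(0)) = sum_(k >= 1) (-1)^(k-1) u^k / k, u = f / f(0) - 1, when
   f(0) != 0. The term k = 0 vanishes because 0^-1 = 0. *)
Definition pslog n (f : fps n) : fps n :=
  let log1p : fps 1 := fun m => (-1) ^+ (m ord0).-1 / (m ord0)%:R in
  pscomp log1p (fun _ => psnormalize f).

(* Formal maps from C^n to C^k, by components. *)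
Definition formal_map (n k : nat) : Type := 'I_k -> fps n.

Definition idmap n : formal_map n n := fun i => psX i.
Definition mcomp n k l (F : formal_map k l) (G : formal_map n k) : formal_map n l :=
  fun i => pscomp (F i) G.
Definition mconj n k (F : formal_map n k) : formal_map n k := fun i m => (F i m)^*.

Definition fixes0 n k (F : formal_map n k) : Prop := forall i, F i 0%MM = 0.

(* Linear part at the origin, acting on column vectors. *)
Definition jacobian n k (F : formal_map n k) : 'M[C]_(k, n) :=
  \matrix_(i, j) F i U_(j)%MM.

(* Absolute convergence on some closed polydisc of positive radius. *)
Definition convergent n (f : fps n) : Prop :=
  exists r B : R, 0 < r /\
    forall d, \sum_(m : 'X_{1..n < d}) `|f m| * r%:C ^+ mdeg m <= B%:C.

(* Germs at 0 of holomorphic maps fixing 0, identified with their Taylor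
   series. *)
Definition holomorphic_germ n k (F : formal_map n k) : Prop :=
  fixes0 F /\ forall i, convergent (F i).

(* Holomorphic and anti-holomorphic (formal) self-maps of C^n:
   Hol F is z |-> F(z) and Anti F is z |-> F(conj z). *)
Inductive selfmap (n : nat) : Type :=
  | Hol of formal_map n n
  | Anti of formal_map n n.

Definition scomp n (f g : selfmap n) : selfmap n :=
  match f, g with
  | Hol F, Hol G => Hol (mcomp F G)
  | Hol F, Anti G => Anti (mcomp F G)
  | Anti F, Hol G => Anti (mcomp F (mconj G))
  | Anti F, Anti G => Hol (mcomp F (mconj G))
  end.

Definition is_involution n (f : selfmap n) : Prop :=
  scomp f f = Hol (@idmap n).

Definition formal_inverse n (F G : formal_map n n) : Prop :=
  [/\ fixes0 F, fixes0 G, mcomp F G = @idmap n & mcomp G F = @idmap n].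

(* Psi^-1 f Psi, where Psi' is the inverse of Psi. *)
Definition conjugate n (Psi Psi' : formal_map n n) (f : selfmap n) : selfmap n :=
  scomp (Hol Psi') (scomp f (Hol Psi)).

(* arg z lies in (0, pi/2) (for z != 0) *)
Definition arg_acute (z : C) : Prop :=
  exists theta : R, 0 < theta < trigo.pi / 2 /\
    z = `|z| * (trigo.cos theta +i* trigo.sin theta).

Section NormalForms.

(* Indices are 0-based: j is elliptic if j < es, hyperbolic if
   es <= j < es + hs, and the remaining ones are complex, j being paired with
   j + ss for es + hs <= j < p - ss.
   The coordinates (xi, eta) of C^(2p) are indexed by 'I_(p + p), xi_j being
   the coordinate lshift p j and eta_j the coordinate rshift p j. *)
Variables (es hs ss p : nat).

Definition eigenvalues_normalized (lam mu : 'I_p -> C) : Prop :=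
  [/\ forall j, mu j = lam j ^+ 2,
      forall j : 'I_p, (j < es)%N -> 1 < lam j,
      forall j : 'I_p, (es <= j < es + hs)%N ->
        `|lam j| = 1 /\ arg_acute (lam j),
      forall j : 'I_p, (es + hs <= j < p - ss)%N ->
        1 < `|lam j| /\ arg_acute (lam j)
    & forall j k : 'I_p, (es + hs <= j < p - ss)%N -> k = (j + ss)%N :> nat ->
        lam k = ((lam j)^*)^-1].

Definition nonresonant (mu : 'I_p -> C) : Prop :=
  forall Q : 'rV[int]_p, Q != 0 -> \prod_(j < p) mu j ^ Q 0 j != 1.

Definition hatS (mu : 'I_p -> C) : 'M[C]_(p + p) :=
  block_mx (diag_mx (\row_j mu j)) 0 0 (diag_mx (\row_j (mu j)^-1)).

(* s |-> s + ss and s + ss |-> s on complex indices, identity elsewhere; the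
   default value of insubd is never used when es + hs + 2 * ss = p. *)
Definition partner (j : 'I_p) : 'I_p :=
  if (j < es + hs)%N then j
  else if (j < p - ss)%N then insubd j (j + ss)%N
  else insubd j (j - ss)%N.

Definition std_rho : selfmap (p + p) :=
  Anti (fun i => match split i with
    | inl j => if (j < es)%N then psX (rshift p j) else psX (lshift p (partner j))
    | inr j => if (j < es)%N then psX (lshift p j) else psX (rshift p (partner j))
    end).

(* xi eta = (xi_1 eta_1, ..., xi_p eta_p) *)
Definition xieta : formal_map (p + p) p :=
  fun j => psmul (psX (lshift p j)) (psX (rshift p j)).

(* xi_j' = M_j(xi eta) xi_j, eta_j' = M_j^-1(xi eta) eta_j *)
Definition sigma_form (M : formal_map p p) : selfmap (p + p) :=
  Hol (fun i => match split i with
    | inl j => psmul (pscomp (M j) xieta) (psX (lshift p j))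
    | inr j => psmul (pscomp (psinv (M j)) xieta) (psX (rshift p j))
    end).

(* xi_j' = L_j(xi eta) eta_j, eta_j' = L_j^-1(xi eta) xi_j *)
Definition tau_form (L : formal_map p p) : selfmap (p + p) :=
  Hol (fun i => match split i with
    | inl j => psmul (pscomp (L j) xieta) (psX (rshift p j))
    | inr j => psmul (pscomp (psinv (L j)) xieta) (psX (lshift p j))
    end).

Definition normalizes (rho sigma tau1 tau2 : selfmap (p + p))
    (Psi Psi' : formal_map (p + p) (p + p)) (M L1 L2 : formal_map p p) : Prop :=
  [/\ formal_inverse Psi Psi',
      forall j, [/\ M j 0%MM != 0, L1 j 0%MM != 0 & L2 j 0%MM != 0],
      conjugate Psi Psi' rho = std_rho,
      conjugate Psi Psi' sigma = sigma_form M
    & conjugate Psi Psi' tau1 = tau_form L1 /\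
      conjugate Psi Psi' tau2 = tau_form L2].

Definition logM (M : formal_map p p) : formal_map p p :=
  fun j => if (j < es)%N then pslog (M j) else psscale (- 'i%C) (pslog (M j)).

(* F(zeta) = zeta + O(|zeta|^2) *)
Definition tangent_to_id (F : formal_map p p) : Prop :=
  forall j (m : 'X_{1..p}), (mdeg m <= 1)%N -> F j m = psX j m.

(* The j-th component of F(zeta) - zeta does not involve zeta_j. *)
Definition diagonal_free (F : formal_map p p) : Prop :=
  forall j (m : 'X_{1..p}), m j != 0%N -> F j m - psX j m = 0.

End NormalForms.

End FormalSeries.

(* Main.v *)
Require Import Defs.
From HB Require Import structures.
From mathcomp Require Import all_boot all_order all_algebra.
From mathcomp Require Import perm boolp reals complex mpoly.
From mathcomp Require Import ring zify.

(** Since convergence plays no role, everything happens in the ring of formal power series, where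
equations are solved as fixed points of maps that gain one order of vanishing.

Normal form: Poincaré–Dulac gives coordinates in which sigma commutes with its linear part S.
Since tau_i and rho conjugate sigma to its inverse, they intertwine S and its inverse as well; by
nonresonance this forces their components to be monomials times series in xi eta. Averaging
T + rho_0 T rho conjugates rho to the standard involution rho_0 by a map commuting with S, and the
involution that tau_i induces on zeta = xi eta is tangent to the identity, hence trivial.

Diagonal normalization: a map (a_j(xi eta) xi_j, b_j(xi eta) eta_j) replaces log M by (log M) o A
with A_j = a_j b_j zeta_j, so A is the unique solution of a fixed point equation; uniqueness makes
A commute with the involution induced by rho, because log M does. The ratios a_j / b_j are then
determined, up to roots of unity, by the condition on the product of the Lambda_ij.

Uniqueness: a map between two such normal forms intertwines their linear parts, hence has the
shape above, and uniqueness of A applies. *)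

Set Implicit Arguments.
Unset Strict Implicit.
Unset Printing Implicit Defensive.

Import Order.TTheory GRing.Theory Num.Theory.

Local Open Scope ring_scope.
Local Open Scope complex_scope.

(** * The ring of formal power series *)

(** What turns nonlinear intertwining into conditions on single monomials is the uniqueness of the
    semisimple part: once two maps commute with their diagonal linear parts, any formal map
    intertwining them intertwines those linear parts. Nonresonance then leaves only the monomials
    [x_(w i) (xi eta)^k] in component [i], so every map becomes a family of series in [zeta]
    attached to an index map [w], and composition becomes a rule on such families.

    Two difficulties are hidden in the statement. The change of coordinates must commute with [rho],
    preserve the shape of sigma and make the product of the two Lambda trivial, all at once; this is
    why fourth roots occur and why the coefficients are assembled from pieces that [rho] fixes or
    exchanges. In the second half the normalizing map is arbitrary, so [M(0)] is not known to be
    [mu]: nonresonance has to be carried over from sigma, whose spectrum is the same up to a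
    permutation. *)

(* The operations are locked so that unification never unfolds them to sums of
   coefficients. *)
HB.lock Definition fpsadd (R : realType) n (f g : fps R n) : fps R n := fun m => f m + g m.
HB.lock Definition fpsopp (R : realType) n (f : fps R n) : fps R n := fun m => - f m.
HB.lock Definition fpsmul (R : realType) n (f g : fps R n) : fps R n := psmul f g.
HB.lock Definition fpsC (R : realType) n (c : R[i]) : fps R n := psconst c.
HB.lock Definition fpscomp (R : realType) k n (f : fps R k) (G : 'I_k -> fps R n) : fps R n :=
  pscomp f G.
Arguments fpsC {R n}.

Section FpsRing.
Variable R : realType.
Local Notation C := R[i].

(** Series are functions on an infinite set, so the decidable equality and the choice operator
    demanded by the ring structures are classical. *)
HB.instance Definition _ n := gen_eqMixin (fps R n).
HB.instance Definition _ n := gen_choiceMixin (fps R n).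

Lemma fpsP n (f g : fps R n) : (forall m, f m = g m) -> f = g.
Proof. exact: funext. Qed.

Lemma pstruncE n d (f : fps R n) m : (mdeg m <= d)%N -> (pstrunc d f)@_m = f m.
Proof. by move=> ltd; rewrite mcoeff_mpoly ?ltnS. Qed.

Lemma pstrunc_gt n d (f : fps R n) m : (d < mdeg m)%N -> (pstrunc d f)@_m = 0.
Proof.
move=> ltd; rewrite raddf_sum /= big1 // => k _; rewrite mcoeffZ mcoeffX.
case: eqP => [ekm|]; last by rewrite mulr0.
by have := bmdeg k; rewrite ekm ltnS leqNgt ltd.
Qed.

Section Ring.
Variable n : nat.
Implicit Types f g h : fps R n.

Lemma psmul_fpsmul f g : psmul f g = fpsmul f g. Proof. by rewrite unlock. Qed.
Lemma psconst_fpsC c : psconst c = fpsC c :> fps R n. Proof. by rewrite unlock. Qed.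
Lemma fpsaddE f g m : fpsadd f g m = f m + g m. Proof. by rewrite unlock. Qed.
Lemma fpsoppE f m : fpsopp f m = - f m. Proof. by rewrite unlock. Qed.
Lemma fpsCE c m : (fpsC c : fps R n) m = c *+ (m == 0%MM). Proof. by rewrite unlock. Qed.

Lemma fpsaddA : associative (@fpsadd R n).
Proof. by move=> f g h; apply: fpsP => m; rewrite !fpsaddE addrA. Qed.
Lemma fpsaddC : commutative (@fpsadd R n).
Proof. by move=> f g; apply: fpsP => m; rewrite !fpsaddE addrC. Qed.
Lemma fpsadd0 : left_id (@fpsC R n 0) (@fpsadd R n).
Proof. by move=> f; apply: fpsP => m; rewrite !fpsaddE ?fpsoppE fpsCE mul0rn add0r. Qed.
Lemma fpsaddN : left_inverse (@fpsC R n 0) (@fpsopp R n) (@fpsadd R n).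
Proof. by move=> f; apply: fpsP => m; rewrite !fpsaddE ?fpsoppE fpsCE mul0rn addNr. Qed.

HB.instance Definition _ :=
  GRing.isZmodule.Build (fps R n) fpsaddA fpsaddC fpsadd0 fpsaddN.

Lemma fpsmulE f g m : fpsmul f g m =
  \sum_(k : 'X_{1..n < (mdeg m).+1, (mdeg m).+1} | m == (k.1 + k.2)%MM)
     (f k.1 * g k.2).
Proof.
rewrite unlock /psmul mcoeffM; apply: eq_bigr => k _.
by rewrite !pstruncE // -ltnS bmdeg.
Qed.

(** The bridge to polynomials: a coefficient of a product sees its factors only up to its own
    degree, so any polynomials agreeing with them there compute it. The ring axioms are inherited in
    this way. *)
Lemma fpsmul_mcoeff (p q : {mpoly C[n]}) f g m :
  (forall k, (mdeg k <= mdeg m)%N -> f k = p@_k) ->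
  (forall k, (mdeg k <= mdeg m)%N -> g k = q@_k) ->
  fpsmul f g m = (p * q)@_m.
Proof.
move=> efp egq; rewrite fpsmulE mcoeffM; apply: eq_bigr => k _.
by rewrite efp ?egq // -ltnS bmdeg.
Qed.

Lemma fpsmulA : associative (@fpsmul R n).
Proof.
move=> f g h; apply: fpsP => m; set d := mdeg m.
have T (f' : fps R n) k : (mdeg k <= d)%N -> f' k = (pstrunc d f')@_k.
  by move=> lkd; rewrite pstruncE.
have TM (f' g' : fps R n) k : (mdeg k <= d)%N ->
    fpsmul f' g' k = (pstrunc d f' * pstrunc d g')@_k.
  by move=> lkd; apply: fpsmul_mcoeff => k' lk'; apply: T; apply: leq_trans lkd.
by rewrite (fpsmul_mcoeff (T f) (TM g h)) (fpsmul_mcoeff (TM f g) (T h)) mulrA.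
Qed.

Lemma fpsmulC : commutative (@fpsmul R n).
Proof. by move=> f g; apply: fpsP => m; rewrite unlock /psmul mulrC. Qed.

Lemma fpsmul1 : left_id (@fpsC R n 1) (@fpsmul R n).
Proof.
move=> f; apply: fpsP => m.
rewrite (@fpsmul_mcoeff 1 (pstrunc (mdeg m) f)) ?mul1r ?pstruncE //.
  by move=> k _; rewrite mcoeff1 fpsCE.
by move=> k lk; rewrite pstruncE.
Qed.

Lemma fpsmulDl : left_distributive (@fpsmul R n) +%R.
Proof.
move=> f g h; apply: fpsP => m; rewrite fpsmulE.
rewrite [RHS]fpsaddE.
by rewrite !fpsmulE -big_split /=; apply: eq_bigr => k _; rewrite -mulrDl -fpsaddE.
Qed.

Lemma fps1_neq0 : @fpsC R n 1 != 0.
Proof.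
apply/eqP => e; have h : (@fpsC R n 1) 0%MM = (@fpsC R n 0) 0%MM by rewrite [fpsC 1]e.
by move: h; rewrite !fpsCE eqxx mulr1n mul0rn => /eqP; rewrite oner_eq0.
Qed.

HB.instance Definition _ :=
  GRing.Zmodule_isComNzRing.Build (fps R n) fpsmulA fpsmulC fpsmul1 fpsmulDl fps1_neq0.

Lemma fpscoef0 m : (0 : fps R n) m = 0. Proof. by rewrite [LHS]fpsCE mul0rn. Qed.
Lemma fpscoef1 m : (1 : fps R n) m = (m == 0%MM)%:R. Proof. exact: fpsCE. Qed.
Lemma fpscoefD f g m : (f + g) m = f m + g m. Proof. exact: fpsaddE. Qed.
Lemma fpscoefN f m : (- f) m = - f m. Proof. exact: fpsoppE. Qed.
Lemma fpscoefB f g m : (f - g) m = f m - g m. Proof. by rewrite fpscoefD fpscoefN. Qed.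

Lemma fpscoef_sum I (r : seq I) (P : pred I) (F : I -> fps R n) m :
  (\sum_(i <- r | P i) F i) m = \sum_(i <- r | P i) F i m.
Proof. by elim/big_rec2: _ => [|i x y _ <-]; rewrite ?fpscoef0 ?fpscoefD. Qed.

Lemma fpscoefM f g m : (f * g) m =
  \sum_(k : 'X_{1..n < (mdeg m).+1, (mdeg m).+1} | m == (k.1 + k.2)%MM)
     (f k.1 * g k.2).
Proof. exact: fpsmulE. Qed.

Lemma pssubE f g : pssub f g = f - g. Proof. by apply: fpsP => m; rewrite fpscoefB. Qed.

Definition fps_of_mpoly (p : {mpoly C[n]}) : fps R n := fun m => p@_m.

Lemma fps_of_mpoly_is_zmod_morphism : zmod_morphism fps_of_mpoly.
Proof. by move=> p q; apply: fpsP => m; rewrite fpscoefB /fps_of_mpoly mcoeffB. Qed.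
Lemma fps_of_mpoly_is_monoid_morphism : monoid_morphism fps_of_mpoly.
Proof.
split; first by apply: fpsP => m; rewrite fpscoef1 /fps_of_mpoly mcoeff1.
by move=> p q; apply: fpsP => m; symmetry; apply: fpsmul_mcoeff.
Qed.
HB.instance Definition _ :=
  GRing.isZmodMorphism.Build _ _ fps_of_mpoly fps_of_mpoly_is_zmod_morphism.
HB.instance Definition _ :=
  GRing.isMonoidMorphism.Build _ _ fps_of_mpoly fps_of_mpoly_is_monoid_morphism.

Lemma fps_of_mpolyC c : fps_of_mpoly c%:MP = @fpsC R n c.
Proof. by apply: fpsP => m; rewrite /fps_of_mpoly mcoeffC fpsCE mulr_natr. Qed.
Lemma fps_of_mpolyX i : fps_of_mpoly 'X_i = psX R i.
Proof. by apply: fpsP => m; rewrite /fps_of_mpoly mcoeffX /psX eq_sym. Qed.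

Lemma fpsC_is_zmod_morphism : zmod_morphism (@fpsC R n).
Proof. by move=> a b; rewrite -!fps_of_mpolyC mpolyCB rmorphB. Qed.
Lemma fpsC_is_monoid_morphism : monoid_morphism (@fpsC R n).
Proof. by split=> // a b; rewrite -!fps_of_mpolyC mpolyCM rmorphM. Qed.
HB.instance Definition _ :=
  GRing.isZmodMorphism.Build _ _ (@fpsC R n) fpsC_is_zmod_morphism.
HB.instance Definition _ :=
  GRing.isMonoidMorphism.Build _ _ (@fpsC R n) fpsC_is_monoid_morphism.

Lemma fpscoefC c m : (fpsC c : fps R n) m = c *+ (m == 0%MM). Proof. exact: fpsCE. Qed.
Lemma fpscoefCM c f m : (@fpsC R n c * f) m = c * f m.
Proof.
rewrite -fps_of_mpolyC [LHS](@fpsmul_mcoeff c%:MP (pstrunc (mdeg m) f)) //.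
  by rewrite mcoeffCM pstruncE.
by move=> k lk; rewrite pstruncE.
Qed.
Lemma psscaleE c f : psscale c f = @fpsC R n c * f.
Proof. by apply: fpsP => m; rewrite fpscoefCM. Qed.

Lemma fpscoefX (i : 'I_n) m : psX R i m = (m == U_(i)%MM)%:R. Proof. by []. Qed.

Lemma mnm1_neq0 (i : 'I_n) : (0%MM == U_(i)%MM :> 'X_{1..n}) = false.
Proof. by apply/negbTE/eqP => /(congr1 (@mdeg n)); rewrite mdeg0 mdeg1. Qed.

Lemma fpscoefX0 (i : 'I_n) : psX R i 0%MM = 0.
Proof. by rewrite fpscoefX mnm1_neq0. Qed.

Lemma fpscoefM0 f g : (f * g) 0%MM = f 0%MM * g 0%MM.
Proof.
rewrite [LHS](@fpsmul_mcoeff (f 0%MM)%:MP (g 0%MM)%:MP).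
- by rewrite -mpolyCM mcoeffC eqxx mulr1.
- by move=> k; rewrite mdeg0 leqn0 mdeg_eq0 => /eqP->; rewrite mcoeffC eqxx mulr1.
by move=> k; rewrite mdeg0 leqn0 mdeg_eq0 => /eqP->; rewrite mcoeffC eqxx mulr1.
Qed.

Lemma fpscoefX0n f k : (f ^+ k) 0%MM = f 0%MM ^+ k.
Proof. by elim: k => [|k IH]; rewrite ?expr0 ?fpscoef1 ?eqxx // !exprS fpscoefM0 IH. Qed.


(** Membership in the [d]-th power of the maximal ideal. Approximation is always expressed as
    [order_ge d (f - g)], and [order_ge_eq] says that this topology is separated. *)
Definition order_ge d f := forall m, (mdeg m < d)%N -> f m = 0.

Lemma order_ge0 d : order_ge d 0. Proof. by move=> m _; rewrite fpscoef0. Qed.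
Lemma order_ge_le d d' f : (d' <= d)%N -> order_ge d f -> order_ge d' f.
Proof. by move=> led uf m ltm; apply: uf; apply: leq_trans led. Qed.
Lemma order_geD d f g : order_ge d f -> order_ge d g -> order_ge d (f + g).
Proof. by move=> uf ug m lm; rewrite fpscoefD uf ?ug ?addr0. Qed.
Lemma order_geN d f : order_ge d f -> order_ge d (- f).
Proof. by move=> uf m lm; rewrite fpscoefN uf ?oppr0. Qed.
Lemma order_geB d f g : order_ge d f -> order_ge d g -> order_ge d (f - g).
Proof. by move=> uf ug; exact: order_geD uf (order_geN ug). Qed.
Lemma order_ge_sum d I (r : seq I) (P : pred I) (F : I -> fps R n) :
  (forall i, P i -> order_ge d (F i)) -> order_ge d (\sum_(i <- r | P i) F i).
Proof. by move=> oF; apply: big_ind => //; [apply: order_ge0 | move=> ? ?; apply: order_geD]. Qed.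

Lemma order_geM a b f g : order_ge a f -> order_ge b g -> order_ge (a + b) (f * g).
Proof.
move=> uf ug m lm; rewrite fpscoefM big1 // => k /eqP em.
have [l1|l1] := ltnP (mdeg k.1) a; first by rewrite uf ?mul0r.
have [l2|l2] := ltnP (mdeg k.2) b; first by rewrite ug ?mulr0.
by have := leq_add l1 l2; rewrite -mdegD -(congr1 (@mdeg n) em) leqNgt lm.
Qed.

Lemma order_ge_zero f : order_ge 0 f. Proof. by []. Qed.

Lemma order_ge1P f : order_ge 1 f <-> f 0%MM = 0.
Proof.
split=> [->|f0 m]; rewrite ?mdeg0 //.
by rewrite ltnS leqn0 mdeg_eq0 => /eqP->.
Qed.

Lemma order_geMr d f g : order_ge d g -> order_ge d (f * g).
Proof. by move=> og; have := order_geM (order_ge_zero f) og. Qed.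
Lemma order_geMl d f g : order_ge d f -> order_ge d (f * g).
Proof. by rewrite mulrC; apply: order_geMr. Qed.

Lemma order_geX (i : 'I_n) : order_ge 1 (psX R i).
Proof. by apply/order_ge1P/fpscoefX0. Qed.

Lemma order_geXn d k f : order_ge d f -> order_ge (k * d) (f ^+ k).
Proof. by move=> uf; elim: k => // k IH; rewrite mulSn exprS; apply: order_geM. Qed.

Lemma order_ge_eq f g : (forall d, order_ge d (f - g)) -> f = g.
Proof. by move=> o; apply: fpsP => m; apply/eqP; rewrite -subr_eq0 -fpscoefB (o (mdeg m).+1). Qed.

Lemma order_ge_subP d f g : order_ge d (f - g) <-> (forall m, (mdeg m < d)%N -> f m = g m).
Proof.
split=> fg m lm; last by rewrite fpscoefB fg ?subrr.
by apply/eqP; rewrite -subr_eq0; apply/eqP; rewrite -(fg m lm) fpscoefB.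
Qed.

Lemma order_ge_trunc d f : order_ge d.+1 (f - fps_of_mpoly (pstrunc d f)).
Proof. by move=> m lm; rewrite fpscoefB [fps_of_mpoly _ _]pstruncE ?subrr. Qed.

Lemma order_ge_sub_trans d f g h : order_ge d (f - g) -> order_ge d (g - h) -> order_ge d (f - h).
Proof. by move=> o1 o2; have := order_geD o1 o2; rewrite addrA subrK. Qed.

Lemma order_ge_sub_sym d f g : order_ge d (f - g) -> order_ge d (g - f).
Proof. by move=> /order_geN; rewrite opprB. Qed.

Lemma order_ge_subB d f f' g g' : order_ge d (f - f') -> order_ge d (g - g') ->
  order_ge d ((f - g) - (f' - g')).
Proof.
move=> o1 o2; have -> : f - g - (f' - g') = (f - f') - (g - g') by ring.
exact: order_geB.
Qed.

Lemma order_ge_subM d f f' g g' : order_ge d (f - f') -> order_ge d (g - g') -> order_ge d (f * g - f' * g').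
Proof.
move=> o1 o2.
have -> : f * g - f' * g' = (f - f') * g + f' * (g - g') by ring.
by apply: order_geD; [apply: order_geMl | apply: order_geMr].
Qed.

End Ring.
End FpsRing.

(** * Substitution *)

Section Composition.
Variable R : realType.
Local Notation C := R[i].

Section Eval.
Variables k n : nat.
Implicit Types (f g : fps R k) (G H : formal_map R n k) (p q : {mpoly C[k]}).

(** Substitution into polynomials is a ring morphism with no condition on [G]; the laws of [fpscomp]
    are deduced from it by approximating the outer series. *)
Definition fpseval G : {mpoly C[k]} -> fps R n := mmap (@fpsC R n) G.
HB.instance Definition _ G := GRing.RMorphism.on (fpseval G).

Lemma fpsevalC G c : fpseval G c%:MP = fpsC c.
Proof. exact: mmapC. Qed.

Lemma fpsevalX G i : fpseval G 'X_i = G i.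
Proof. by rewrite /fpseval mmapX mmap1U. Qed.

Lemma fpsevalE G p : fpseval G p = \sum_(m <- msupp p) fpsC p@_m * mmap1 G m.
Proof. by []. Qed.

Lemma order_ge_mmap1 G m : fixes0 G -> order_ge (mdeg m) (mmap1 G m).
Proof.
move=> G0; rewrite mdegE /mmap1; elim/big_rec2: _ => [|i d f _ IH]; first exact: order_ge_zero.
by apply: order_geM => //; have := @order_geXn R n 1 (m i) (G i); rewrite muln1; apply; apply/order_ge1P/G0.
Qed.

Lemma order_ge_mmap1_sub d G H m :
  (forall i, order_ge d (G i - H i)) -> order_ge d (mmap1 G m - mmap1 H m).
Proof.
move=> GH; rewrite /mmap1; elim/big_rec2: _ => [|i f g _ IH].
  by rewrite subrr; apply: order_ge0.
apply: order_ge_subM => //; elim: (m i) => [|j IHj]; first by rewrite subrr; apply: order_ge0.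
by rewrite !exprS; apply: order_ge_subM.
Qed.

Lemma order_ge_eval d G p : fixes0 G -> order_ge d (fps_of_mpoly p) -> order_ge d (fpseval G p).
Proof.
move=> G0 op; rewrite fpsevalE big_seq; apply: order_ge_sum => m mp.
apply: order_geMr; apply: (order_ge_le _ (order_ge_mmap1 G0));  rewrite leqNgt; apply/negP => lt.
by move: mp; rewrite mcoeff_msupp => /negP; apply; apply/eqP/op.
Qed.

Lemma order_ge_eval_sub d G H p : (forall i, order_ge d (G i - H i)) ->
  order_ge d (fpseval G p - fpseval H p).
Proof.
move=> GH; rewrite !fpsevalE -sumrB; apply: order_ge_sum => m _.
by rewrite -mulrBr; apply/order_geMr/order_ge_mmap1_sub.
Qed.

Lemma fps_of_mpoly_comp p (lq : k.-tuple {mpoly C[n]}) :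
  fps_of_mpoly (p \mPo lq) = fpseval (fun i => fps_of_mpoly (tnth lq i)) p.
Proof.
rewrite /comp_mpoly /mmap rmorph_sum fpsevalE; apply: eq_bigr => m _.
by rewrite rmorphM /= fps_of_mpolyC rmorph_prod; congr (_ * _); apply: eq_bigr => i _; rewrite rmorphXn.
Qed.

(** [pscomp] truncates both the outer and the inner series. Truncating the inner ones alters the
    result only beyond degree [mdeg m], so the outer truncation alone remains. *)
Lemma fpscompE f G m : fpscomp f G m = fpseval G (pstrunc (mdeg m) f) m.
Proof.
rewrite unlock /pscomp; set lq := [tuple _ | i < k]; set p := pstrunc _ f.
transitivity (fps_of_mpoly (p \mPo lq) m) => //; rewrite fps_of_mpoly_comp.
have /order_ge_subP : order_ge (mdeg m).+1 (fpseval (fun i => fps_of_mpoly (tnth lq i)) p - fpseval G p).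
  apply: order_ge_eval_sub => i.
  by rewrite tnth_mktuple; apply/order_ge_sub_sym/order_ge_trunc.
by apply.
Qed.

Lemma order_ge_comp_eval d f G : fixes0 G -> order_ge d.+1 (fpscomp f G - fpseval G (pstrunc d f)).
Proof.
move=> G0 m; rewrite ltnS => lm. rewrite fpscoefB fpscompE.
rewrite [LHS](_ : _ = fpseval G (pstrunc (mdeg m) f - pstrunc d f) m); last by rewrite rmorphB /= fpscoefB.
apply: (@order_ge_eval (mdeg m).+1) => // k'; rewrite ltnS => lk.
by rewrite [LHS]mcoeffB !pstruncE ?subrr // (leq_trans lk).
Qed.

(** Any polynomial approximation of [f] may replace its truncation. This is what lets products be
    treated, since a product of truncations is not the truncation of the product. *)
Lemma order_ge_comp_poly d f G p : fixes0 G -> order_ge d (f - fps_of_mpoly p) ->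
  order_ge d (fpscomp f G - fpseval G p).
Proof.
move=> G0 fp; apply: order_ge_sub_trans (order_ge_le (leqnSn _) (@order_ge_comp_eval d f G G0)) _.
rewrite -rmorphB /=; apply: order_ge_eval => //; rewrite rmorphB /=.
by apply: order_ge_sub_trans fp; apply/order_ge_sub_sym/(order_ge_le (leqnSn _))/order_ge_trunc.
Qed.

Lemma fpscomp_of_mpoly p G : fixes0 G -> fpscomp (fps_of_mpoly p) G = fpseval G p.
Proof.
move=> G0; apply: order_ge_eq => d; apply: order_ge_comp_poly => //.
by rewrite subrr; apply: order_ge0.
Qed.

Lemma fpscompC c G : fixes0 G -> fpscomp (fpsC c) G = fpsC c.
Proof. by move=> G0; rewrite -fps_of_mpolyC fpscomp_of_mpoly // fpsevalC. Qed.

Lemma fpscompX i G : fixes0 G -> fpscomp (psX R i) G = G i.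
Proof. by move=> G0; rewrite -fps_of_mpolyX fpscomp_of_mpoly // fpsevalX. Qed.

Lemma fpscomp1 G : fixes0 G -> fpscomp 1 G = 1.
Proof. exact: fpscompC. Qed.

Lemma fpscompB f g G : fixes0 G -> fpscomp (f - g) G = fpscomp f G - fpscomp g G.
Proof.
move=> G0; apply: order_ge_eq => d; pose T := fun h : fps R k => pstrunc d h.
apply: (order_ge_le (leqnSn _)); apply: (@order_ge_sub_trans _ _ _ _ (fpseval G (T f - T g))).
  by apply: order_ge_comp_poly => //; rewrite rmorphB /=; apply: order_ge_subB; apply: order_ge_trunc.
rewrite rmorphB /=; apply: order_ge_subB; apply: order_ge_sub_sym; exact: order_ge_comp_eval.
Qed.

Lemma fpscompM f g G : fixes0 G -> fpscomp (f * g) G = fpscomp f G * fpscomp g G.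
Proof.
move=> G0; apply: order_ge_eq => d; pose T := fun h : fps R k => pstrunc d h.
apply: (order_ge_le (leqnSn _)); apply: (@order_ge_sub_trans _ _ _ _ (fpseval G (T f * T g))).
  by apply: order_ge_comp_poly => //; rewrite rmorphM /=; apply: order_ge_subM; apply: order_ge_trunc.
rewrite rmorphM /=; apply: order_ge_subM; apply: order_ge_sub_sym; exact: order_ge_comp_eval.
Qed.

End Eval.
End Composition.

Definition fmcomp (R : realType) n k l (F : formal_map R k l) (G : formal_map R n k) : formal_map R n l :=
  fun i => fpscomp (F i) G.

Lemma fmcompE R n k l (F : formal_map R k l) (G : formal_map R n k) : mcomp F G = fmcomp F G.
Proof. by apply: funext => i; rewrite /fmcomp unlock. Qed.

Section CompositionTheory.
Variable R : realType.
Local Notation C := R[i].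

Section Fixed.
Variables (k n : nat) (G : formal_map R n k).
Hypothesis G0 : fixes0 G.
Implicit Types f g : fps R k.

Lemma fpscomp0 : fpscomp 0 G = 0 :> fps R n.
Proof. by rewrite -[0 in LHS](subrr 0) fpscompB // subrr. Qed.

Lemma fpscompN f : fpscomp (- f) G = - fpscomp f G.
Proof. by rewrite -sub0r fpscompB // fpscomp0 sub0r. Qed.

Lemma fpscompD f g : fpscomp (f + g) G = fpscomp f G + fpscomp g G.
Proof. by rewrite -[g in LHS]opprK fpscompB // fpscompN opprK. Qed.

Lemma fpscomp_sum I (r : seq I) (P : pred I) (F : I -> fps R k) :
  fpscomp (\sum_(i <- r | P i) F i) G = \sum_(i <- r | P i) fpscomp (F i) G.
Proof. by elim/big_rec2: _ => [|i x y _ <-]; rewrite ?fpscomp0 ?fpscompD. Qed.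

Lemma fpscomp_prod I (r : seq I) (P : pred I) (F : I -> fps R k) :
  fpscomp (\prod_(i <- r | P i) F i) G = \prod_(i <- r | P i) fpscomp (F i) G.
Proof. by elim/big_rec2: _ => [|i x y _ <-]; rewrite ?fpscomp1 ?fpscompM. Qed.

Lemma fpscompXn f j : fpscomp (f ^+ j) G = fpscomp f G ^+ j.
Proof. by elim: j => [|j IH]; rewrite ?expr0 ?fpscomp1 // !exprS fpscompM // IH. Qed.

Lemma order_ge_comp d f : order_ge d f -> order_ge d (fpscomp f G).
Proof.
move=> fd; have := @order_ge_comp_poly _ _ _ d f G 0 G0.
by rewrite !rmorph0 !subr0; apply.
Qed.

End Fixed.

Lemma fpscomp_at0 k n (f : fps R k) (G : formal_map R n k) :
  fpscomp f G 0%MM = f 0%MM.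
Proof.
rewrite fpscompE mdeg0.
have -> : pstrunc 0 f = (f 0%MM)%:MP.
  apply/mpolyP => m; rewrite mcoeffC; have [->|m0] := eqVneq m 0%MM.
    by rewrite mulr1 pstruncE ?mdeg0.
  by rewrite mulr0 pstrunc_gt // lt0n mdeg_eq0.
by rewrite fpsevalC fpscoefC eqxx.
Qed.

Lemma fixes0_comp n k l (F : formal_map R k l) (G : formal_map R n k) :
  fixes0 F -> fixes0 (fmcomp F G).
Proof. by move=> F0 i; rewrite /fmcomp fpscomp_at0. Qed.

Lemma fixes0_id n : fixes0 (@idmap R n).
Proof. by move=> i; apply: fpscoefX0. Qed.

Lemma fpscompA n k l (f : fps R l) (G : formal_map R k l) (H : formal_map R n k) :
  fixes0 G -> fixes0 H ->
  fpscomp (fpscomp f G) H = fpscomp f (fmcomp G H).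
Proof.
move=> G0 H0; apply: order_ge_eq => d; have GH0 := fixes0_comp H G0.
have [o1 o2] := (@order_ge_comp_eval _ _ _ d f G G0, @order_ge_comp_eval _ _ _ d f _ GH0).
apply: (order_ge_le (leqnSn _)).
apply: (order_ge_sub_trans (g := fpscomp (fpseval G (pstrunc d f)) H)).
  by rewrite -fpscompB //; apply: order_ge_comp.
apply: (order_ge_sub_trans _ (order_ge_sub_sym o2)).
rewrite [X in order_ge _ X](_ : _ = 0); first exact: order_ge0.
apply/eqP; rewrite subr_eq0; apply/eqP.
rewrite !fpsevalE fpscomp_sum //; apply: eq_bigr => m _.
rewrite fpscompM // fpscompC //; congr (_ * _).
by rewrite fpscomp_prod //; apply: eq_bigr => i _; rewrite fpscompXn.
Qed.

Lemma fmcompA n k l j (F : formal_map R l j) (G : formal_map R k l) (H : formal_map R n k) :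
  fixes0 G -> fixes0 H -> fmcomp (fmcomp F G) H = fmcomp F (fmcomp G H).
Proof. by move=> G0 H0; apply: funext => i; apply: fpscompA. Qed.

Lemma fpscomp_id n (f : fps R n) : fpscomp f (@idmap R n) = f.
Proof.
apply: fpsP => m; rewrite fpscompE -[RHS](pstruncE f (leqnn (mdeg m))).
suff -> : fpseval (@idmap R n) (pstrunc (mdeg m) f) = fps_of_mpoly (pstrunc (mdeg m) f) by [].
rewrite [pstrunc _ _]mpolyE !rmorph_sum; apply: eq_bigr => k _.
rewrite -mul_mpolyC !rmorphM /= fpsevalC fps_of_mpolyC; congr (_ * _).
rewrite /fpseval mmapX mpolyXE_id rmorph_prod; apply: eq_bigr => i _.
by rewrite rmorphXn /= fps_of_mpolyX.
Qed.

Lemma fmcomp1f n k (F : formal_map R n k) : fixes0 F -> fmcomp (@idmap R k) F = F.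
Proof. by move=> F0; apply: funext => i; apply: fpscompX. Qed.

Lemma fmcompf1 n k (F : formal_map R n k) : fmcomp F (@idmap R n) = F.
Proof. by apply: funext => i; apply: fpscomp_id. Qed.

Lemma mmap1D n k (G : formal_map R n k) m1 m2 : mmap1 G (m1 + m2)%MM = mmap1 G m1 * mmap1 G m2.
Proof. by apply: commr_mmap1_M => i x; apply: mulrC. Qed.

(** Telescoping over the factors of the monomial: each term contains one difference [G i - H i], of
    order [d], and [mdeg m - 1] further factors of order 1. *)
Lemma order_ge_mmap1_sub1 n k d (G H : formal_map R n k) m :
  fixes0 G -> fixes0 H -> (forall i, order_ge d (G i - H i)) ->
  order_ge ((mdeg m).-1 + d) (mmap1 G m - mmap1 H m).
Proof.
move=> G0 H0 GH; move e: (mdeg m) => b; elim: b m e => [|b IH] m e.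
  by move/eqP: e; rewrite mdeg_eq0 => /eqP->; rewrite !mmap11 subrr; apply: order_ge0.
have [i mi] : exists i, m i != 0%N.
  apply/existsP; rewrite -negb_forall; apply/negP => /forallP m0.
  by move: e; rewrite mdegE big1 // => i _; apply/eqP.
rewrite -lep1mP in mi; rewrite -(submK mi) addmC !mmap1D !mmap1U /=.
set m' := (m - _)%MM.
have m'b : mdeg m' = b.
  by have := congr1 (@mdeg _) (submK mi); rewrite mdegD mdeg1 e addn1 => -[].
have -> : G i * mmap1 G m' - H i * mmap1 H m' =
   mmap1 G m' * (G i - H i) + H i * (mmap1 G m' - mmap1 H m') by ring.
apply: order_geD; first by apply: order_geM (GH i); rewrite -m'b; apply: order_ge_mmap1.
apply: (@order_ge_le _ _ (1 + (b.-1 + d))); first lia.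
by apply: order_geM; [apply/order_ge1P | apply: IH].
Qed.

(* If G and H agree below degree d and f = O(a + 1), then f o G and f o H agree below degree
   a + d: this gain makes the equations below contractive. *)
Lemma order_ge_comp_sub n k a d f (G H : formal_map R n k) :
  fixes0 G -> fixes0 H -> (forall i, order_ge d (G i - H i)) -> order_ge a.+1 f ->
  order_ge (a + d) (fpscomp f G - fpscomp f H).
Proof.
move=> G0 H0 GH fa; set D := (a + d)%N; set p := pstrunc D f.
have [oG oH] := (@order_ge_comp_eval _ _ _ D f G G0, @order_ge_comp_eval _ _ _ D f H H0).
apply: (order_ge_sub_trans (order_ge_le (leqnSn _) oG)).
apply: order_ge_sub_sym; apply: (order_ge_sub_trans (order_ge_le (leqnSn _) oH)).
rewrite -/p !fpsevalE -sumrB big_seq; apply: order_ge_sum => m mp.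
rewrite -mulrBr; apply: order_geMr; apply: (order_ge_le _ (order_ge_mmap1_sub1 _ _ _)) => //; last first.
  by move=> i; apply: order_ge_sub_sym.
suff : (a < mdeg m)%N by rewrite /D; case: (mdeg m) => //= b; rewrite ltnS leq_add2r.
rewrite ltnNge; apply/negP => lma; move: mp; rewrite mcoeff_msupp => /eqP; apply.
have [ld|ld] := leqP (mdeg m) D; last exact: pstrunc_gt.
by rewrite pstruncE // fa.
Qed.

Lemma order_ge2P n (f : fps R n) : order_ge 2 f <-> f 0%MM = 0 /\ forall i, f U_(i)%MM = 0.
Proof.
split=> [f2|[f0 f1] m]; first by split=> [|i]; apply: f2; rewrite ?mdeg0 ?mdeg1.
rewrite ltnS leq_eqVlt ltnS leqn0 mdeg_eq0 => /orP[/mdeg1P[i /eqP->]|/eqP->] //.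
Qed.

Lemma fpscoefX1 n (i j : 'I_n) : psX R i U_(j)%MM = (i == j)%:R.
Proof. by rewrite fpscoefX eq_mnm1 eq_sym. Qed.

Lemma affine_part n (f : fps R n) :
  order_ge 2 (f - (fpsC (f 0%MM) + \sum_i fpsC (f U_(i)%MM) * psX R i)).
Proof.
apply/order_ge2P; split=> [|j]; rewrite fpscoefB fpscoefD fpscoefC fpscoef_sum.
  by rewrite eqxx big1 ?addr0 ?subrr // => i _; rewrite fpscoefCM fpscoefX0 mulr0.
rewrite mnm1_eq0 mulr0n add0r (bigD1 j) //= fpscoefCM fpscoefX1 eqxx mulr1.
rewrite big1 ?addr0 ?subrr // => i ij; rewrite fpscoefCM fpscoefX1 (negbTE ij) mulr0 //.
Qed.

(** The chain rule at the origin: modulo order 2 the outer series may be replaced by its affine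
    part. *)
Lemma fpscomp_at1 k n (f : fps R k) (G : formal_map R n k) j : fixes0 G ->
  fpscomp f G U_(j)%MM = \sum_i f U_(i)%MM * G i U_(j)%MM.
Proof.
move=> G0; have /order_ge_subP e := order_ge_comp G0 (affine_part f).
have {e} /order_ge_subP e : order_ge 2 (fpscomp f G - fpscomp (fpsC (f 0%MM) + \sum_i fpsC (f U_(i)%MM) * psX R i) G).
  by rewrite -fpscompB //; apply: order_ge_comp => //; apply: affine_part.
rewrite e ?mdeg1 // fpscompD // fpscompC // fpscomp_sum // fpscoefD fpscoefC mnm1_eq0 add0r.
by rewrite fpscoef_sum; apply: eq_bigr => i _; rewrite fpscompM // fpscompC // fpscompX // fpscoefCM.
Qed.

Lemma jacobianM n k l (F : formal_map R k l) (G : formal_map R n k) : fixes0 G ->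
  jacobian (fmcomp F G) = jacobian F *m jacobian G.
Proof.
by move=> G0; apply/matrixP => i j; rewrite !mxE /fmcomp fpscomp_at1 //; apply: eq_bigr => a _; rewrite !mxE.
Qed.

Lemma jacobian_id n : jacobian (@idmap R n) = 1%:M.
Proof. by apply/matrixP => i j; rewrite !mxE [LHS]fpscoefX1. Qed.

Definition fpsconj n (f : fps R n) : fps R n := fun m => (f m)^*.

Lemma fpsconj_is_zmod_morphism n : zmod_morphism (@fpsconj n).
Proof. by move=> f g; apply: fpsP => m; rewrite /fpsconj !fpscoefB rmorphB. Qed.
Lemma fpsconj_is_monoid_morphism n : monoid_morphism (@fpsconj n).
Proof.
split; first by apply: fpsP => m; rewrite /fpsconj !fpscoef1 rmorph_nat.
move=> f g; apply: fpsP => m; rewrite /fpsconj !fpscoefM rmorph_sum; apply: eq_bigr => i _.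
by rewrite rmorphM.
Qed.
HB.instance Definition _ n :=
  GRing.isZmodMorphism.Build _ _ (@fpsconj n) (@fpsconj_is_zmod_morphism n).
HB.instance Definition _ n :=
  GRing.isMonoidMorphism.Build _ _ (@fpsconj n) (@fpsconj_is_monoid_morphism n).

Lemma fpsconjK n : involutive (@fpsconj n).
Proof. by move=> f; apply: fpsP => m; apply: conjcK. Qed.
Lemma fpsconjC n c : fpsconj (fpsC c) = fpsC c^* :> fps R n.
Proof. by apply: fpsP => m; rewrite /fpsconj !fpscoefC rmorphMn. Qed.
Lemma fpsconjX n (i : 'I_n) : fpsconj (psX R i) = psX R i.
Proof. by apply: fpsP => m; rewrite /fpsconj !fpscoefX rmorph_nat. Qed.
Lemma order_ge_conj n d (f : fps R n) : order_ge d f -> order_ge d (fpsconj f).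
Proof. by move=> fd m /fd; rewrite /fpsconj => ->; rewrite rmorph0. Qed.

Lemma mconjK n k : involutive (@mconj R n k).
Proof. by move=> F; apply: funext => i; apply: fpsconjK. Qed.
Lemma mconj_id n : mconj (@idmap R n) = @idmap R n.
Proof. by apply: funext => i; apply: fpsconjX. Qed.
Lemma fixes0_conj n k (F : formal_map R n k) : fixes0 F -> fixes0 (mconj F).
Proof. by move=> F0 i; rewrite /mconj F0 rmorph0. Qed.

Lemma fpsconj_comp n k (f : fps R k) (G : formal_map R n k) : fixes0 G ->
  fpsconj (fpscomp f G) = fpscomp (fpsconj f) (mconj G).
Proof.
move=> G0; have cG0 := fixes0_conj G0; apply: order_ge_eq => d; set p := pstrunc d f.
apply: (order_ge_le (leqnSn _)); apply: (order_ge_sub_trans (g := fpsconj (fpseval G p))).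
  by rewrite -rmorphB; apply: order_ge_conj; apply: order_ge_comp_eval.
apply: (order_ge_sub_trans (g := fpscomp (fpsconj (fps_of_mpoly p)) (mconj G))); last first.
  by rewrite -fpscompB // -rmorphB; apply: order_ge_comp => //; apply/order_ge_conj/order_ge_sub_sym/order_ge_trunc.
rewrite [X in order_ge _ X](_ : _ = 0); first exact: order_ge0.
apply/eqP; rewrite subr_eq0; apply/eqP.
rewrite fpsevalE [X in fps_of_mpoly X]mpolyE !rmorph_sum fpscomp_sum //; apply: eq_bigr => m _.
rewrite -mul_mpolyC !rmorphM /= fps_of_mpolyC fpscompM // !fpsconjC fpscompC //; congr (_ * _).
rewrite mpolyXE_id (rmorph_prod (@fps_of_mpoly R k)) /mmap1 !(rmorph_prod (@fpsconj _)) fpscomp_prod //; apply: eq_bigr => i _.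
by rewrite !rmorphXn /= fps_of_mpolyX fpsconjX fpscompXn // fpscompX.
Qed.

Lemma mconj_comp n k l (F : formal_map R k l) (G : formal_map R n k) : fixes0 G ->
  mconj (fmcomp F G) = fmcomp (mconj F) (mconj G).
Proof. by move=> G0; apply: funext => i; apply: fpsconj_comp. Qed.

End CompositionTheory.

(** * Contractions, inverses and self-maps *)

Section FixedPoint.
Variable R : realType.
Local Notation C := R[i].

Section Contraction.
Variables (T : Type) (n a : nat) (Phi : (T -> fps R n) -> (T -> fps R n)).
Hypothesis Phia : forall u, (forall i, order_ge a (u i)) -> forall i, order_ge a (Phi u i).
Hypothesis PhiC : forall d u v, (forall i, order_ge a (u i)) -> (forall i, order_ge a (v i)) ->
  (forall i, order_ge d (u i - v i)) -> forall i, order_ge d.+1 (Phi u i - Phi v i).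

Lemma contraction_unique u v :
  (forall i, order_ge a (u i)) -> (forall i, order_ge a (v i)) -> Phi u = u -> Phi v = v -> u = v.
Proof.
move=> ua va eu ev; have o d : forall i, order_ge d (u i - v i).
  by elim: d => [|d IH] i; [exact: order_ge_zero | rewrite -eu -ev; apply: PhiC].
by apply: funext => i; apply: order_ge_eq => d; apply: o.
Qed.

Lemma contraction_exists : exists2 u, (forall i, order_ge a (u i)) & Phi u = u.
Proof.
pose it j := iter j Phi (fun=> 0).
have ita j : forall i, order_ge a (it j i) by elim: j => [|j IH] i; [exact: order_ge0 | exact: Phia].
have itS e j : forall i, order_ge j (it (j + e)%N i - it j i).
  by elim: j => [|j IH] i; [exact: order_ge_zero | rewrite addSn /it !iterS; apply: PhiC; [exact: ita | exact: ita | exact: IH]].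
(* All iterates of index above [mdeg m] have the same coefficient at [m], so the limit can be read
   off diagonally. *)
pose u i : fps R n := fun m => it (mdeg m).+1 i m.
have uit d i : order_ge d (u i - it d i).
  apply/order_ge_subP => m lm; rewrite /u -(subnKC lm).
  have /order_ge_subP h := itS (d - (mdeg m).+1)%N (mdeg m).+1 i.
  by rewrite [RHS]h.
have ua i : order_ge a (u i).
  by move=> m lm; exact: (ita _ i m lm).
exists u => //; apply: funext => i; apply: order_ge_eq => d.
apply: (order_ge_le (leqnSn d)); apply: (order_ge_sub_trans (g := Phi (it d) i)).
  by apply: PhiC => // j; apply: uit.
by apply: order_ge_sub_sym; apply: (uit d.+1).
Qed.

End Contraction.

Definition linear_part n (F : formal_map R n n) (c : 'I_n -> C) :=
  forall i, order_ge 2 (F i - fpsC (c i) * psX R i).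

Lemma linear_part0 n (F : formal_map R n n) c : linear_part F c -> fixes0 F.
Proof.
move=> Fc i; have := Fc i 0%MM; rewrite mdeg0 fpscoefB fpscoefCM fpscoefX0 mulr0 subr0.
exact.
Qed.

Lemma linear_partP n (F : formal_map R n n) c : fixes0 F ->
  linear_part F c <-> jacobian F = diag_mx (\row_i c i).
Proof.
move=> F0; split=> [Fc|/matrixP J i].
  apply/matrixP => i j; rewrite !mxE; have /order_ge2P[_ /(_ j) /eqP] := Fc i.
  by rewrite fpscoefB fpscoefCM fpscoefX1 subr_eq0 mulr_natr => /eqP.
apply/order_ge2P; split=> [|j]; rewrite fpscoefB fpscoefCM.
  by rewrite F0 fpscoefX0 mulr0 subr0.
by have := J i j; rewrite !mxE => ->; rewrite fpscoefX1 mulr_natr subrr.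
Qed.

Lemma order_ge_lin_sub n d (c : C) (f g h: fps R n) :
  c != 0 -> order_ge d.+1 (f - g) -> order_ge d.+1 (fpsC c^-1 * (h - f) - fpsC c^-1 * (h - g)).
Proof.
move=> c0 fg; rewrite -mulrBr; apply: order_geMr.
have -> : h - f - (h - g) = g - f by ring.
exact: order_ge_sub_sym.
Qed.

(** Write [F = c x + f] with [f] of order 2. Then [F o G = id] is the fixed point equation
    [G = c^-1 (x - f o G)], contractive because [f] has no linear term. *)
Lemma right_inverse n (F : formal_map R n n) c : (forall i, c i != 0) -> linear_part F c ->
  exists2 G, fmcomp F G = @idmap R n & linear_part G (fun i => (c i)^-1).
Proof.
move=> c0 Fc; pose f i := F i - fpsC (c i) * psX R i.
pose Phi (G : formal_map R n n) : formal_map R n n :=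
  fun i => fpsC (c i)^-1 * (psX R i - fpscomp (f i) G).
have f0 i : order_ge 1 (f i) by apply: (order_ge_le _ (Fc i)).
have [||G G0 eG] := @contraction_exists 'I_n n 1 Phi.
- move=> u u1 i; apply: order_geMr; apply: order_geB; first exact: order_geX.
  by apply: order_ge_comp => // j; apply/order_ge1P.
- move=> d u v u1 v1 uv i; apply: order_ge_lin_sub => //.
  by apply: (order_ge_comp_sub (a := 1)) (Fc i) => // j; apply/order_ge1P.
have G0' : fixes0 G by move=> i; apply/order_ge1P.
exists G; last first.
  move=> i; rewrite -[in G i]eG /Phi mulrBr addrAC subrr sub0r; apply/order_geN/order_geMr.
  exact: (order_ge_comp G0' (Fc i)).
apply: funext => i; rewrite /fmcomp.
have -> : F i = fpsC (c i) * psX R i + f i by rewrite addrC subrK.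
rewrite fpscompD // fpscompM // fpscompC // fpscompX // -[in G i]eG /Phi.
by rewrite mulrA -rmorphM mulfV // rmorph1 mul1r subrK.
Qed.

Lemma formal_inverseE n (F G : formal_map R n n) : formal_inverse F G <->
  [/\ fixes0 F, fixes0 G, fmcomp F G = @idmap R n & fmcomp G F = @idmap R n].
Proof. by rewrite /formal_inverse !fmcompE. Qed.

(** The right inverse [G] has a right inverse [H] in turn, and associativity gives
    [F = F o G o H = H]. *)
Lemma exists_inverse n (F : formal_map R n n) c : (forall i, c i != 0) -> linear_part F c ->
  exists2 G, formal_inverse F G & linear_part G (fun i => (c i)^-1).
Proof.
move=> c0 Fc; have [G FG Gc] := right_inverse c0 Fc.
have ci0 i : (c i)^-1 != 0 by rewrite invr_eq0.
have [H GH Hc] := right_inverse ci0 Gc.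
have [[F0 G0] H0] := (linear_part0 Fc, linear_part0 Gc, linear_part0 Hc).
exists G => //; apply/formal_inverseE; split=> //.
suff -> : F = H by [].
by rewrite -[LHS]fmcompf1 -GH -fmcompA // FG fmcomp1f.
Qed.

End FixedPoint.

Section SelfMaps.
Variable R : realType.
Variable n : nat.
Implicit Types f g h : selfmap R n.

Definition sfix f := match f with Hol F => fixes0 F | Anti F => fixes0 F end.

Definition sid : selfmap R n := Hol (@idmap R n).

Lemma sfix_comp f g : sfix f -> sfix (scomp f g).
Proof. by case: f g => F [] G /= F0; rewrite fmcompE; apply: fixes0_comp. Qed.

Lemma scompA f g h : sfix g -> sfix h -> scomp (scomp f g) h = scomp f (scomp g h).
Proof.
by case: f g h => F [] G [] H /= G0 H0;
  rewrite !fmcompE ?mconj_comp ?fmcompA ?mconjK //; (try apply: fixes0_conj).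
Qed.

Lemma scomp1f f : sfix f -> scomp sid f = f.
Proof. by case: f => F F0 /=; rewrite fmcompE fmcomp1f. Qed.

Lemma scompf1 f : scomp f sid = f.
Proof. by case: f => F /=; rewrite fmcompE ?mconj_id fmcompf1. Qed.

Lemma formal_inverse_sym (F G : formal_map R n n) : formal_inverse F G -> formal_inverse G F.
Proof. by case. Qed.

Lemma formal_inverse_comp (F G F' G' : formal_map R n n) :
  formal_inverse F F' -> formal_inverse G G' -> formal_inverse (fmcomp F G) (fmcomp G' F').
Proof.
move=> /formal_inverseE[F0 F'0 FF F'F] /formal_inverseE[G0 G'0 GG G'G].
apply/formal_inverseE; split; try exact: fixes0_comp.
  rewrite fmcompA //; last exact: fixes0_comp.
  by rewrite -[fmcomp G _]fmcompA // GG fmcomp1f.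
rewrite fmcompA //; last exact: fixes0_comp.
by rewrite -[fmcomp F' _]fmcompA // F'F fmcomp1f.
Qed.

Section Conjugation.
Variables Psi Psi' : formal_map R n n.
Hypothesis PsiV : formal_inverse Psi Psi'.

Lemma conjugate_fix f : sfix (conjugate Psi Psi' f).
Proof. by case: PsiV => ? ? _ _; apply: sfix_comp. Qed.

Lemma conjugate_comp f g : sfix f -> sfix g ->
  conjugate Psi Psi' (scomp f g) = scomp (conjugate Psi Psi' f) (conjugate Psi Psi' g).
Proof.
case: PsiV => P0 P'0 PP P'P f0 g0; rewrite /conjugate.
have s1 : scomp (Hol Psi) (Hol Psi') = sid by rewrite /= PP.
have [fP gP] : sfix (scomp f (Hol Psi)) /\ sfix (scomp g (Hol Psi)) by split; apply: sfix_comp.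
have P'gP : sfix (scomp (Hol Psi') (scomp g (Hol Psi))) by apply: sfix_comp.
rewrite (scompA f) // (scompA (Hol Psi')) // (scompA f) // -(scompA (Hol Psi)) //.
by rewrite s1 scomp1f.
Qed.

Lemma conjugate_id : conjugate Psi Psi' sid = sid.
Proof. by case: PsiV => P0 P'0 PP P'P; rewrite /conjugate scomp1f //= P'P. Qed.

Lemma conjugateP f g : sfix f -> sfix g ->
  conjugate Psi Psi' f = g <-> scomp f (Hol Psi) = scomp (Hol Psi) g.
Proof.
case: PsiV => P0 P'0 PP P'P f0 g0.
have s1 : scomp (Hol Psi) (Hol Psi') = sid by rewrite /= PP.
have s2 : scomp (Hol Psi') (Hol Psi) = sid by rewrite /= P'P.
have fP : sfix (scomp f (Hol Psi)) by apply: sfix_comp.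
rewrite /conjugate; split=> [<-|->]; first by rewrite -scompA // s1 scomp1f.
by rewrite -scompA // s2 scomp1f.
Qed.

End Conjugation.

Lemma conjugate_conjugate (Psi Psi' Phi Phi' : formal_map R n n) f :
  formal_inverse Psi Psi' -> formal_inverse Phi Phi' -> sfix f ->
  conjugate Phi Phi' (conjugate Psi Psi' f) = conjugate (fmcomp Psi Phi) (fmcomp Phi' Psi') f.
Proof.
case=> P0 P'0 _ _ [Q0 Q'0 _ _] f0; rewrite /conjugate.
have -> : Hol (fmcomp Psi Phi) = scomp (Hol Psi) (Hol Phi) by rewrite /= fmcompE.
have -> : Hol (fmcomp Phi' Psi') = scomp (Hol Phi') (Hol Psi') by rewrite /= fmcompE.
have fP : sfix (scomp f (Hol Psi)) by apply: sfix_comp.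
have PQ : sfix (scomp f (scomp (Hol Psi) (Hol Phi))) by apply: sfix_comp.
by rewrite (scompA (Hol Psi')) // (scompA f) // (scompA (Hol Phi')).
Qed.

Lemma conjugate_inv (Psi Psi' : formal_map R n n) f g :
  formal_inverse Psi Psi' -> sfix f -> conjugate Psi Psi' f = g -> conjugate Psi' Psi g = f.
Proof.
move=> PV f0 <-; rewrite (conjugate_conjugate PV (formal_inverse_sym PV) f0).
case/formal_inverseE: PV => _ _ e _; rewrite e.
rewrite -[LHS]/(scomp sid (scomp f sid)) (scompf1 f).
exact: scomp1f.
Qed.

End SelfMaps.

(** * Inverses, logarithms and roots of power series *)

HB.lock Definition fpsinv (R : realType) n (f : fps R n) : fps R n := psinv f.
HB.lock Definition fpslog (R : realType) n (f : fps R n) : fps R n := pslog f.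

Section UnitsAndLogarithms.
Variable R : realType.
Local Notation C := R[i].

Lemma pscomp_fpscomp k n (f : fps R k) (G : formal_map R n k) : pscomp f G = fpscomp f G.
Proof. by rewrite unlock. Qed.

Lemma fpscoefMXm n (f : fps R n) (k m : 'X_{1..n}) :
  (f * fps_of_mpoly 'X_[k]) m = if (k <= m)%MM then f (m - k)%MM else 0.
Proof.
rewrite fpscoefM; case: ifP => [km|/negP nkm]; last first.
  rewrite big1 // => -[k1 k2] /= /eqP em; rewrite [fps_of_mpoly _ _]mcoeffX.
  case: eqP => [e|]; last by rewrite mulr0.
  by case: nkm; rewrite em -e lem_addl.
have d1 : (mdeg (m - k) < (mdeg m).+1)%N by rewrite ltnS mdegB.
have d2 : (mdeg k < (mdeg m).+1)%N.
  by rewrite ltnS -(submK km) mdegD leq_addl.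
rewrite (bigD1 (BMultinom d1, BMultinom d2)) /=; last by rewrite submK.
rewrite [fps_of_mpoly _ _]mcoeffX eqxx mulr1 big1 ?addr0 // => -[k1 k2] /= /andP[/eqP em ne].
rewrite [fps_of_mpoly _ _]mcoeffX; case: eqP => [e|]; last by rewrite mulr0.
case/eqP: ne; congr pair; apply: val_inj => //=.
by apply: (@addIm _ k); rewrite submK // [RHS]em; congr (_ + _)%MM.
Qed.

Lemma fpscoefMX n (f : fps R n) i m :
  (f * psX R i) m = if m i == 0%N then 0 else f (m - U_(i))%MM.
Proof. by rewrite -fps_of_mpolyX fpscoefMXm lep1mP; case: eqP. Qed.

Lemma mulX_inj n (f g : fps R n) i : f * psX R i = g * psX R i -> f = g.
Proof.
move=> e; apply: fpsP => m; have := congr1 (fun h : fps R n => h (m + U_(i))%MM) e.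
by rewrite /= !fpscoefMX mnmDE mnm1E eqxx addn1 /= addmK.
Qed.

Definition geom : fps R 1 := fun m => (-1) ^+ m ord0.
Definition log1p : fps R 1 := fun m => (-1) ^+ (m ord0).-1 / (m ord0)%:R.

Definition fpsnormalize n (f : fps R n) : fps R n := fpsC (f 0%MM)^-1 * f - 1.

Lemma psnormalizeE n (f : fps R n) : psnormalize f = fpsnormalize f.
Proof. by rewrite /psnormalize pssubE psscaleE psconst_fpsC rmorph1. Qed.

Lemma psinv_fpsinv n (f : fps R n) : psinv f = fpsinv f.
Proof. by rewrite fpsinv.unlock. Qed.
Lemma pslog_fpslog n (f : fps R n) : pslog f = fpslog f.
Proof. by rewrite fpslog.unlock. Qed.

Lemma fpsinvE n (f : fps R n) : fpsinv f = fpsC (f 0%MM)^-1 * fpscomp geom (fun _ => fpsnormalize f).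
Proof. by rewrite fpsinv.unlock /psinv psscaleE pscomp_fpscomp psnormalizeE. Qed.

Lemma fpslogE n (f : fps R n) : fpslog f = fpscomp log1p (fun _ => fpsnormalize f).
Proof. by rewrite fpslog.unlock /pslog pscomp_fpscomp psnormalizeE. Qed.

Lemma fpsnormalize0 n (f : fps R n) : f 0%MM != 0 -> fpsnormalize f 0%MM = 0.
Proof. by move=> f0; rewrite /fpsnormalize fpscoefB fpscoefCM mulVf // fpscoef1 eqxx subrr. Qed.

Lemma fixes0_fpsnormalize n (f : fps R n) : f 0%MM != 0 -> fixes0 (fun _ : 'I_1 => fpsnormalize f).
Proof. by move=> f0 i; apply: fpsnormalize0. Qed.

Lemma fpsnormalizeK n (f : fps R n) : f 0%MM != 0 -> f = fpsC (f 0%MM) * (1 + fpsnormalize f).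
Proof. by move=> f0; rewrite /fpsnormalize addrC subrK mulrA -rmorphM mulfV // rmorph1 mul1r. Qed.

Lemma geomP : geom * (1 + psX R ord0) = 1.
Proof.
apply: fpsP => m; rewrite mulrDr mulr1 fpscoefD fpscoefMX fpscoef1 /geom.
have [m0|m0] := eqVneq (m ord0) 0%N.
  have -> : m = 0%MM by apply/mnmP => i; rewrite ord1 m0 mnm0E.
  by rewrite mnm0E expr0 addr0 eqxx.
have -> : (m == 0%MM) = false by apply/negbTE; apply: contra m0 => /eqP->; rewrite mnm0E.
rewrite mnmBE mnm1E eqxx subn1 -{1}(prednK (n := m ord0)) ?lt0n // exprS.
by rewrite mulN1r addNr.
Qed.

Lemma fpsinvP n (f : fps R n) : f 0%MM != 0 -> f * fpsinv f = 1.
Proof.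
move=> f0; have n0 := fixes0_fpsnormalize f0; rewrite {1}(fpsnormalizeK f0) fpsinvE mulrACA -rmorphM mulfV //.
rewrite rmorph1 mul1r -[RHS](fpscomp1 n0) -geomP fpscompM // fpscompD // fpscomp1 // fpscompX //.
by rewrite mulrC.
Qed.

Lemma fps_regular n (f g h : fps R n) : f 0%MM != 0 -> f * g = f * h -> g = h.
Proof.
move=> f0 e; rewrite -[g]mul1r -[h]mul1r -(fpsinvP f0) ![f * fpsinv f]mulrC -!mulrA.
by rewrite e.
Qed.

Lemma unit_at0 n (f g : fps R n) : f * g = 1 -> f 0%MM != 0.
Proof.
move=> fg; apply/eqP => f0; have /eqP := congr1 (fun h : fps R n => h 0%MM) fg.
by rewrite fpscoefM0 f0 mul0r fpscoef1 eqxx eq_sym oner_eq0.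
Qed.

Lemma fpsinv_unique n (f g : fps R n) : f * g = 1 -> g = fpsinv f.
Proof. by move=> fg; apply: (fps_regular (unit_at0 fg)); rewrite fpsinvP ?(unit_at0 fg). Qed.

Lemma fpsinv0 n (f : fps R n) : f 0%MM != 0 -> fpsinv f 0%MM = (f 0%MM)^-1.
Proof.
move=> f0; apply: (mulfI f0); rewrite -fpscoefM0 fpsinvP // fpscoef1 eqxx mulfV //.
Qed.

Lemma fpsinvK n (f : fps R n) : f 0%MM != 0 -> fpsinv (fpsinv f) = f.
Proof. by move=> f0; symmetry; apply: fpsinv_unique; rewrite mulrC fpsinvP. Qed.

Lemma fpsinv_comp n k (f : fps R k) (G : formal_map R n k) : fixes0 G -> f 0%MM != 0 ->
  fpscomp (fpsinv f) G = fpsinv (fpscomp f G).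
Proof. by move=> G0 f0; apply: fpsinv_unique; rewrite -fpscompM // fpsinvP // fpscomp1. Qed.

Lemma fpsnormalize_comp n k (f : fps R k) (G : formal_map R n k) : fixes0 G ->
  fpsnormalize (fpscomp f G) = fpscomp (fpsnormalize f) G.
Proof. by move=> G0; rewrite /fpsnormalize fpscompB // fpscompM // fpscompC // fpscomp1 // fpscomp_at0. Qed.

Lemma fpslog_comp n k (f : fps R k) (G : formal_map R n k) : fixes0 G -> f 0%MM != 0 ->
  fpslog (fpscomp f G) = fpscomp (fpslog f) G.
Proof.
move=> G0 f0; rewrite !fpslogE fpscompA //; last exact: fixes0_fpsnormalize.
by congr fpscomp; apply: funext => i; rewrite fpsnormalize_comp.
Qed.

Lemma fpslog_conj n (f : fps R n) : f 0%MM != 0 -> fpsconj (fpslog f) = fpslog (fpsconj f).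
Proof.
move=> f0; rewrite !fpslogE fpsconj_comp //; last exact: fixes0_fpsnormalize.
have -> : fpsconj log1p = log1p.
  apply: fpsP => m; rewrite /fpsconj /log1p rmorphM fmorphV rmorphXn rmorphN1 rmorph_nat //.
congr fpscomp; apply: funext => i; rewrite -[LHS]/(fpsconj (fpsnormalize f)) /fpsnormalize rmorphB rmorphM /= fpsconjC.
by rewrite fmorphV rmorph1.
Qed.

Lemma fpslog0 n (f : fps R n) : fpslog f 0%MM = 0.
Proof. by rewrite fpslogE fpscomp_at0 /log1p mnm0E invr0 mulr0. Qed.

(** Derivatives serve to prove identities between logarithms: in characteristic zero a series is
    determined by its constant term and its partial derivatives. *)
Definition fpsderiv n (i : 'I_n) (f : fps R n) : fps R n :=
  fun m => f (m + U_(i))%MM *+ (m i).+1.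

Lemma fpsderiv_poly n (i : 'I_n) p : fpsderiv i (fps_of_mpoly p) = fps_of_mpoly p^`M(i).
Proof. by apply: fpsP => m; rewrite /fpsderiv [RHS]mcoeff_mderiv. Qed.

Lemma fpsderiv_is_zmod_morphism n i : zmod_morphism (@fpsderiv n i).
Proof. by move=> f g; apply: fpsP => m; rewrite /fpsderiv !fpscoefB mulrnBl. Qed.
HB.instance Definition _ n i :=
  GRing.isZmodMorphism.Build _ _ (@fpsderiv n i) (@fpsderiv_is_zmod_morphism n i).

Lemma fpsderivD n i (f g : fps R n) : fpsderiv i (f + g) = fpsderiv i f + fpsderiv i g.
Proof. exact: raddfD. Qed.

Lemma order_ge_deriv n i d (f : fps R n) : order_ge d.+1 f -> order_ge d (fpsderiv i f).
Proof. by move=> fd m md; rewrite /fpsderiv fd ?mul0rn // mdegD mdeg1 addn1. Qed.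

Lemma fpsderivM n i (f g : fps R n) : fpsderiv i (f * g) = fpsderiv i f * g + f * fpsderiv i g.
Proof.
apply: order_ge_eq => d; pose p := pstrunc d f; pose q := pstrunc d g.
have [op oq] := (@order_ge_trunc R n d f, @order_ge_trunc R n d g).
apply: (order_ge_sub_trans (g := fpsderiv i (fps_of_mpoly p * fps_of_mpoly q))).
  by rewrite -raddfB; apply: order_ge_deriv; apply: order_ge_subM.
rewrite -rmorphM fpsderiv_poly mderivM rmorphD !rmorphM /= -!fpsderiv_poly.
apply: order_ge_sub_sym.
have -> : fpsderiv i f * g + f * fpsderiv i g -
    (fpsderiv i (fps_of_mpoly p) * fps_of_mpoly q + fps_of_mpoly p * fpsderiv i (fps_of_mpoly q)) =
    (fpsderiv i f * g - fpsderiv i (fps_of_mpoly p) * fps_of_mpoly q) +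
    (f * fpsderiv i g - fps_of_mpoly p * fpsderiv i (fps_of_mpoly q)) by ring.
have dp : order_ge d (fpsderiv i f - fpsderiv i (fps_of_mpoly p)) by rewrite -raddfB; apply: order_ge_deriv.
have dq : order_ge d (fpsderiv i g - fpsderiv i (fps_of_mpoly q)) by rewrite -raddfB; apply: order_ge_deriv.
by apply: order_geD; apply: order_ge_subM => //; apply: (order_ge_le (leqnSn d)).
Qed.

Lemma fpsderivC n i c : fpsderiv i (fpsC c : fps R n) = 0.
Proof. by rewrite -fps_of_mpolyC fpsderiv_poly mderivC rmorph0. Qed.

Lemma fpsderiv1 n i : fpsderiv i (1 : fps R n) = 0.
Proof. by have := fpsderivC i 1; rewrite rmorph1. Qed.

Lemma fpsderiv_eq0 n (f : fps R n) : f 0%MM = 0 -> (forall i, fpsderiv i f = 0) -> f = 0.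
Proof.
move=> f0 df; apply: fpsP => m; rewrite fpscoef0.
have [->//|m0] := eqVneq m 0%MM.
have [i mi] : exists i, m i != 0%N.
  apply/existsP; rewrite -negb_forall; apply: contra m0 => /forallP m0.
  by apply/eqP/mnmP => i; rewrite mnm0E; apply/eqP.
rewrite -lep1mP in mi; have /eqP := congr1 (fun h : fps R n => h (m - U_(i))%MM) (df i).
by rewrite fpscoef0 /fpsderiv submK // mulrn_eq0 /= => /eqP.
Qed.

Lemma fpsderiv_comp1 n i (f : fps R 1) (g : fps R n) : g 0%MM = 0 ->
  fpsderiv i (fpscomp f (fun _ => g)) = fpscomp (fpsderiv ord0 f) (fun _ => g) * fpsderiv i g.
Proof.
move=> g0; have G0 : fixes0 (fun _ : 'I_1 => g) by [].
(* The series obeying the chain rule contain the constants and the variable and are closed under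
   sums and products, hence include all polynomials. Approximation does the rest, differentiation
   costing one order. *)
pose good (h : fps R 1) := fpsderiv i (fpscomp h (fun _ => g)) =
   fpscomp (fpsderiv ord0 h) (fun _ => g) * fpsderiv i g.
have gC c : good (fpsC c).
  by rewrite /good !fpsderivC fpscompC // fpsderivC fpscomp0 // mul0r.
have gD h1 h2 : good h1 -> good h2 -> good (h1 + h2).
  by rewrite /good fpscompD // !raddfD /= fpscompD // mulrDl => -> ->.
have gM h1 h2 : good h1 -> good h2 -> good (h1 * h2).
  rewrite /good fpscompM // !fpsderivM fpscompD // !fpscompM // => -> ->; ring.
have gX j : good (psX R j).
  have -> : j = ord0 by apply: ord1.
  rewrite /good fpscompX //; have -> : fpsderiv ord0 (psX R (ord0 : 'I_1)) = 1.
    rewrite -fps_of_mpolyX fpsderiv_poly mderivX mnm1E eqxx scale1r.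
    by rewrite -{1}[U_(_)%MM]add0m addmK mpolyX0 rmorph1.
  by rewrite fpscomp1 // mul1r.
have gz : good 0 by have := gC 0; rewrite rmorph0.
have go : good 1 by have := gC 1; rewrite rmorph1.
have gp p : good (fps_of_mpoly p).
  rewrite [p]mpolyE rmorph_sum; apply: big_ind => //.
  move=> m _; rewrite -mul_mpolyC rmorphM /= fps_of_mpolyC; apply: (gM) => //.
  rewrite mpolyXE_id rmorph_prod; apply: big_ind => [//|x y|j _]; first exact: (gM).
  rewrite rmorphXn /= fps_of_mpolyX; elim: (m j) => [|e IH]; first by [].
  by rewrite exprS; apply: (gM).
apply: order_ge_eq => d; have o := @order_ge_trunc R 1 d f; set p := pstrunc d f in o.
apply: (order_ge_sub_trans (g := fpsderiv i (fpscomp (fps_of_mpoly p) (fun _ => g)))).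
  by rewrite -raddfB /= -fpscompB //; apply: order_ge_deriv; apply: order_ge_comp.
rewrite gp -mulrBl; apply: order_geMl; rewrite -fpscompB // -raddfB; apply: order_ge_comp => //.
by apply/order_ge_deriv/order_ge_sub_sym.
Qed.

Lemma fpsderiv_log1p : fpsderiv ord0 log1p = geom.
Proof.
apply: fpsP => m; rewrite /fpsderiv /log1p /geom mnmDE mnm1E eqxx addn1 /=.
by rewrite -[LHS]mulr_natr mulfVK // pnatr_eq0.
Qed.

Lemma fpsderiv_log n i (f : fps R n) : f 0%MM != 0 ->
  fpsderiv i (fpslog f) = fpsinv f * fpsderiv i f.
Proof.
move=> f0; rewrite fpslogE fpsderiv_comp1 ?fpsnormalize0 // fpsderiv_log1p fpsinvE /fpsnormalize raddfB /=.
rewrite fpsderivM fpsderivC mul0r add0r fpsderiv1 subr0; ring.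
Qed.

(** Both logarithms vanish at 0, and the derivative of their sum is that of the product
    [f * fpsinv f = 1]. *)
Lemma fpslogV n (f : fps R n) : f 0%MM != 0 -> fpslog (fpsinv f) = - fpslog f.
Proof.
move=> f0; apply/eqP; rewrite -addr_eq0; apply/eqP/fpsderiv_eq0 => [|i].
  by rewrite fpscoefD !fpslog0 addr0.
have i0 : fpsinv f 0%MM != 0 by rewrite fpsinv0 // invr_eq0.
have : fpsderiv i (f * fpsinv f) = 0 by rewrite (fpsinvP f0) fpsderiv1.
rewrite fpsderivM => e; rewrite fpsderivD (fpsderiv_log i f0) (fpsderiv_log i i0) (fpsinvK f0).
by rewrite -e [fpsinv f * _]mulrC addrC.
Qed.

Lemma fps_sqrt1 n (f : fps R n) : f 0%MM = 1 -> exists2 g : fps R n, g 0%MM = 1 & g ^+ 2 = f.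
Proof.
move=> f0; pose c : fps R n := fpsC 2^-1.
have c2 : c * 2 = 1.
  by rewrite /c -(rmorph_nat fpsC) -rmorphM mulVf ?rmorph1 ?pnatr_eq0.
(* With [g = 1 + h], the equation [g^2 = f] reads [h = (f - 1 - h^2) / 2]; the square is contractive
   on series without constant term. *)
pose Phi (h : 'I_1 -> fps R n) := fun _ : 'I_1 => c * (f - 1 - h ord0 ^+ 2).
have [||h h1 eh] := @contraction_exists R 'I_1 n 1 Phi.
- move=> u u1 i; apply: order_geMr; apply: order_geB; first by apply/order_ge1P; rewrite fpscoefB f0 fpscoef1 eqxx subrr.
  by apply: (order_ge_le _ (@order_geXn _ _ 1 2 _ (u1 ord0))).
- move=> d u v u1 v1 uv i; rewrite /Phi -mulrBr; apply: order_geMr.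
  have -> : f - 1 - u ord0 ^+ 2 - (f - 1 - v ord0 ^+ 2) =
    - ((u ord0 - v ord0) * (u ord0 + v ord0)) by ring.
  by apply: order_geN; rewrite -addn1; apply: order_geM => //; apply: order_geD.
exists (1 + h ord0); first by have /order_ge1P h0 := h1 ord0; rewrite fpscoefD h0 fpscoef1 eqxx addr0.
have e : 2 * h ord0 = f - 1 - h ord0 ^+ 2.
  by rewrite -{1}eh /Phi mulrA [2 * c]mulrC c2 mul1r.
rewrite sqrrD expr1n mul1r -mulr_natl e; ring.
Qed.

Lemma fps_sqrt1_unique n (f g : fps R n) : f 0%MM = 1 -> g 0%MM = 1 -> f ^+ 2 = g ^+ 2 -> f = g.
Proof.
move=> f0 g0 e; apply/eqP; rewrite -subr_eq0; apply/eqP.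
apply: (@fps_regular _ (f + g)); last by rewrite mulr0 mulrC -subr_sqr e subrr.
by rewrite fpscoefD f0 g0 (_ : 1 + 1 = 2%:R) ?pnatr_eq0.
Qed.

Lemma fps_sqrt n (f : fps R n) : f 0%MM != 0 -> exists g : fps R n, g ^+ 2 = f.
Proof.
move=> f0; have [|g g0 eg] := @fps_sqrt1 _ (fpsC (f 0%MM)^-1 * f).
  by rewrite fpscoefCM mulVf.
exists (fpsC (sqrtc (f 0%MM)) * g); rewrite exprMn eg -rmorphXn /= sqr_sqrtc mulrA -rmorphM.
by rewrite mulfV // rmorph1 mul1r.
Qed.

Lemma fps_root4 n (f : fps R n) : f 0%MM != 0 -> exists g : fps R n, g ^+ 4 = f.
Proof.
move=> f0; have [h eh] := fps_sqrt f0.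
have h0 : h 0%MM != 0 by move: f0; rewrite -eh fpscoefX0n expf_eq0.
have [g eg] := fps_sqrt h0; exists g.
by rewrite -eh -eg -exprM.
Qed.

End UnitsAndLogarithms.

(** * Semisimple parts and the Poincaré–Dulac normal form *)

Section PoincareDulac.
Variable R : realType.
Local Notation C := R[i].

Section Dilations.
Variable n : nat.
Implicit Types (c : 'I_n -> C) (f g : fps R n) (m : 'X_{1..n}).

Definition cpow c m : C := \prod_i c i ^+ m i.

Lemma cpowU c i : cpow c U_(i)%MM = c i.
Proof.
rewrite /cpow (bigD1 i) //= mnm1E eqxx expr1 big1 ?mulr1 // => j ji.
by rewrite mnm1E eq_sym (negbTE ji) expr0.
Qed.

Lemma cpow_conj c m : (cpow c m)^* = cpow (fun i => (c i)^*) m.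
Proof. by rewrite /cpow rmorph_prod; apply: eq_bigr => i _; rewrite rmorphXn. Qed.

Definition dilation c : formal_map R n n := fun i => fpsC (c i) * psX R i.

Lemma fixes0_dilation c : fixes0 (dilation c).
Proof. by move=> i; rewrite /dilation fpscoefCM fpscoefX0 mulr0. Qed.
Hint Resolve fixes0_dilation : core.

Lemma mmap1_dilation c m : mmap1 (dilation c) m = fpsC (cpow c m) * fps_of_mpoly 'X_[m].
Proof.
rewrite /mmap1 /dilation /cpow rmorph_prod mpolyXE_id rmorph_prod -big_split /=.
by apply: eq_bigr => i _; rewrite exprMn !rmorphXn /= fps_of_mpolyX.
Qed.

Lemma fpscoef_dilation c f m : fpscomp f (dilation c) m = f m * cpow c m.
Proof.
rewrite fpscompE fpsevalE fpscoef_sum.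
rewrite -[f m in RHS](pstruncE f (leqnn _)) -[pstrunc (mdeg m) f in RHS]/(pstrunc (mdeg m) f).
set p := pstrunc _ f; rewrite [in RHS](mpolyE p) raddf_sum mulr_suml; apply: eq_bigr => k _.
rewrite mmap1_dilation mulrA -rmorphM fpscoefCM /= mcoeffZ [fps_of_mpoly _ _]mcoeffX mcoeffX.
by case: eqP => [->|]; rewrite ?mulr0 ?mul0r ?mulr1.
Qed.

Lemma dilation_comp k c (F : formal_map R k n) i : fixes0 F -> fmcomp (dilation c) F i = fpsC (c i) * F i.
Proof. by move=> F0; rewrite /fmcomp /dilation fpscompM // fpscompC // fpscompX. Qed.

(** By [eigenP] this restricts each monomial separately: only those with [cpow c m = l] may
    occur. *)
Definition eigen c (l : C) f := fpscomp f (dilation c) = fpsC l * f.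

Lemma eigenP c l f : eigen c l f <-> forall m, f m * cpow c m = f m * l.
Proof.
split=> [e m|e]; first by rewrite -fpscoef_dilation e fpscoefCM mulrC.
by apply: fpsP => m; rewrite fpscoef_dilation fpscoefCM e mulrC.
Qed.

Lemma eigenB c l f g : eigen c l f -> eigen c l g -> eigen c l (f - g).
Proof. by rewrite /eigen fpscompB // => -> ->; rewrite mulrBr. Qed.

Lemma eigenC c l a f : eigen c l f -> eigen c l (fpsC a * f).
Proof. by rewrite /eigen fpscompM // fpscompC // => ->; rewrite mulrCA. Qed.

Lemma eigen_comp c l f : eigen c l f -> eigen c l (fpscomp f (dilation c)).
Proof. by move=> e; rewrite [fpscomp f _]e; apply: eigenC. Qed.

End Dilations.
Hint Resolve fixes0_dilation : core.

Definition equivariant n (c' c : 'I_n -> C) (F : formal_map R n n) :=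
  forall i, eigen c (c' i) (F i).

Lemma equivariantP n (c' c : 'I_n -> C) (F : formal_map R n n) : fixes0 F ->
  equivariant c' c F <-> fmcomp F (dilation c) = fmcomp (dilation c') F.
Proof.
move=> F0; split=> [e|e i]; first by apply: funext => i; rewrite dilation_comp // -e.
by rewrite /eigen -dilation_comp // -e.
Qed.

Lemma equivariant_comp n (c1 c2 c3 : 'I_n -> C) (F G : formal_map R n n) :
  fixes0 F -> fixes0 G -> equivariant c1 c2 F -> equivariant c2 c3 G ->
  equivariant c1 c3 (fmcomp F G).
Proof.
move=> F0 G0 /equivariantP-/(_ F0) eF /equivariantP-/(_ G0) eG.
by apply/equivariantP; [apply: fixes0_comp | rewrite fmcompA // eG -fmcompA // eF fmcompA].
Qed.

Lemma equivariant_inv n (c1 c2 : 'I_n -> C) (F G : formal_map R n n) :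
  formal_inverse F G -> equivariant c1 c2 F -> equivariant c2 c1 G.
Proof.
move=> /formal_inverseE[F0 G0 FG GF] /equivariantP-/(_ F0) eF.
have S2 := fixes0_comp G (fixes0_dilation c2).
have h : dilation c1 = fmcomp F (fmcomp (dilation c2) G).
  by rewrite -[LHS]fmcompf1 -FG -fmcompA // -eF fmcompA.
by apply/equivariantP => //; rewrite [in LHS]h -[LHS]fmcompA // GF fmcomp1f.
Qed.

(** A nonlinear form of the fact that a matrix intertwining two others intertwines their semisimple
    parts. *)
Lemma intertwine_linear n (c1 c2 : 'I_n -> C) (s1 s2 F : formal_map R n n) :
  fixes0 F -> linear_part s1 c1 -> linear_part s2 c2 ->
  equivariant c1 c1 s1 -> equivariant c2 c2 s2 -> fmcomp F s2 = fmcomp s1 F ->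
  equivariant c1 c2 F.
Proof.
move=> F0 l1 l2 e1 e2 eF; have [s10 s20] := (linear_part0 l1, linear_part0 l2).
(* At degree d the coefficient (c2^m - c1_i) F_im is that of the map Q, which only involves the
   part E of F of degree < d and is equivariant; hence (c2^m - c1_i)^2 F_im = 0. *)
suff H d : forall i m, (mdeg m < d)%N -> F i m * cpow c2 m = F i m * c1 i.
  by move=> i; apply/eigenP => m; apply: (H (mdeg m).+1).
elim: d => // d IH i m; rewrite ltnS leq_eqVlt => /orP[/eqP dm|]; last exact: IH.
have [d0|d0] := posnP d.
  have -> : m = 0%MM by apply/eqP; rewrite -mdeg_eq0 dm d0.
  by rewrite F0 !mul0r.
pose E : formal_map R n n := fun i m => if (mdeg m < d)%N then F i m else 0.
have E0 : fixes0 E by move=> j; rewrite /E F0; case: ifP.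
have oE j : order_ge d (F j - E j) by apply/order_ge_subP => m' lm; rewrite /E lm.
have eE : equivariant c1 c2 E.
  by move=> j; apply/eigenP => m'; rewrite /E; case: ifP => [/IH|]; rewrite ?mul0r.
pose Q j := (fpscomp (s1 j - dilation c1 j) E) - (fpscomp (E j) s2 - fpscomp (E j) (dilation c2)).
have eQ : eigen c2 (c1 i) (Q i).
  apply: eigenB; last apply: eigenB.
  - rewrite fpscompB //; apply: eigenB.
      by have := equivariant_comp s10 E0 e1 eE; apply.
    by rewrite [fpscomp _ E](dilation_comp c1 i E0); apply: eigenC.
  - by have := equivariant_comp E0 s20 eE e2; apply.
  exact: eigen_comp.
have FQ : (fpscomp (F i) (dilation c2) - fpsC (c1 i) * F i) m = Q i m.
  have <- : fpscomp (s1 i - dilation c1 i) F - (fpscomp (F i) s2 - fpscomp (F i) (dilation c2)) =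
      fpscomp (F i) (dilation c2) - fpsC (c1 i) * F i.
    have := congr1 (fun G : formal_map R n n => G i) eF; rewrite /fmcomp => ->.
    rewrite fpscompB // [fpscomp (dilation c1 i) F](dilation_comp c1 i F0); ring.
  (* Replacing [F] by [E] is invisible at degree [d]: one order is gained from [s1 - dilation c1],
     which has order 2, and another from [s2 - dilation c2] in the remaining terms. The latter
     estimate reads [(d - 1) + 2 = d + 1], hence the separate treatment of [d = 0]. *)
  suff /order_ge_subP h : order_ge d.+1 (fpscomp (s1 i - dilation c1 i) F -
      (fpscomp (F i) s2 - fpscomp (F i) (dilation c2)) - Q i) by apply: h; rewrite dm.
  apply: order_ge_subB.
    rewrite -[d.+1]add1n; apply: (order_ge_comp_sub (a := 1)) => //; exact: l1.
  have -> : fpscomp (F i) s2 - fpscomp (F i) (dilation c2) -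
      (fpscomp (E i) s2 - fpscomp (E i) (dilation c2)) =
      fpscomp (F i - E i) s2 - fpscomp (F i - E i) (dilation c2).
    by rewrite !fpscompB //; ring.
  rewrite -(prednK d0) -addn2; apply: order_ge_comp_sub => //; rewrite prednK //; exact: oE.
have : F i m * (cpow c2 m - c1 i) * (cpow c2 m - c1 i) = 0.
  have := eigenP c2 (c1 i) (Q i); case=> /(_ eQ m) /eqP.
  rewrite -FQ fpscoefB fpscoef_dilation fpscoefCM [c1 i * _]mulrC -mulrBr -subr_eq0 -mulrBr => /eqP -> //.
move/eqP; rewrite !mulf_eq0 -orbA orbb => /orP[/eqP->|]; first by rewrite !mul0r.
by rewrite subr_eq0 => /eqP->.
Qed.

Section NormalForm.
Variables (n : nat) (c : 'I_n -> C) (s : formal_map R n n).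
Hypothesis sc : linear_part s c.

(* The unknown u carries both corrections: its nonresonant part is psi = Psi - id, its
   resonant part is rho = s' - dilation c. *)
Let res i m := cpow c m == c i.
Let psi (u : formal_map R n n) i : fps R n := fun m => if res i m then 0 else u i m.
Let rho (u : formal_map R n n) i : fps R n := fun m => if res i m then u i m else 0.
Let Psi u i := psX R i + psi u i.
Let s' u i := dilation c i + rho u i.
(** Expanding [s o Psi = Psi o s'] and moving the linear terms to the left gives the homological
    equation [c_i psi_i - psi_i o dilation c - rho_i = rhs_i]. *)
Let rhs u i := fpscomp (psi u i) (s' u) - fpscomp (psi u i) (dilation c)
  - fpscomp (s i - dilation c i) (Psi u).
(** On the coefficient at [m] the left side of the homological equation is multiplication by
    [c_i - c^m] if [m] is nonresonant, and by [-1] if it is resonant, where only [rho] is present.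
    [kap] is the inverse of this factor. *)
Let kap i m : C := if res i m then -1 else (c i - cpow c m)^-1.
Let Phi (u : formal_map R n n) : formal_map R n n := fun i m => kap i m * rhs u i m.

Let psi_oge d u i : order_ge d (u i) -> order_ge d (psi u i).
Proof. by move=> ud m /ud um; rewrite /psi um; case: ifP. Qed.
Let rho_oge d u i : order_ge d (u i) -> order_ge d (rho u i).
Proof. by move=> ud m /ud um; rewrite /rho um; case: ifP. Qed.
Let psi_sub d u v i : order_ge d (u i - v i) -> order_ge d (psi u i - psi v i).
Proof. by move=> /order_ge_subP uv; apply/order_ge_subP => m /uv e; rewrite /psi e. Qed.
Let rho_sub d u v i : order_ge d (u i - v i) -> order_ge d (rho u i - rho v i).
Proof. by move=> /order_ge_subP uv; apply/order_ge_subP => m /uv e; rewrite /rho e. Qed.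

Let fixes0_Psi u : (forall i, order_ge 2 (u i)) -> fixes0 (Psi u).
Proof.
move=> u2 i; apply/order_ge1P/order_geD; first exact: order_geX.
by apply: (order_ge_le (leqnSn 1)); apply: psi_oge.
Qed.
Let fixes0_s' u : (forall i, order_ge 2 (u i)) -> fixes0 (s' u).
Proof.
move=> u2 i; apply/order_ge1P/order_geD; first by apply/order_ge1P; apply: fixes0_dilation.
by apply: (order_ge_le (leqnSn 1)); apply: rho_oge.
Qed.

Lemma poincare_dulac : exists Psi Psi' s', [/\ formal_inverse Psi Psi',
  linear_part Psi (fun=> 1), linear_part s' c, equivariant c c s' & fmcomp s Psi = fmcomp Psi s'].
Proof.
have [||u u2 eu] := @contraction_exists R 'I_n n 2 Phi.
- move=> u u2 i m lm; rewrite /Phi (_ : rhs u i m = 0) ?mulr0 //.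
  have o : order_ge 2 (rhs u i).
    have [P0 S0] := (fixes0_Psi u2, fixes0_s' u2).
    apply: order_geB; last exact: order_ge_comp.
    by apply: order_geB; apply: order_ge_comp => //; apply: psi_oge.
  exact: o.
- move=> d u v u2 v2 uv i.
  suff /order_ge_subP o : order_ge d.+1 (rhs u i - rhs v i) by apply/order_ge_subP => m lm; rewrite /Phi o.
  have [[P0 S0] [P0' S0']] := ((fixes0_Psi u2, fixes0_s' u2), (fixes0_Psi v2, fixes0_s' v2)).
  have -> : rhs u i - rhs v i =
     ((fpscomp (psi u i - psi v i) (s' u) - fpscomp (psi u i - psi v i) (dilation c)) +
      (fpscomp (psi v i) (s' u) - fpscomp (psi v i) (s' v))) -
     (fpscomp (s i - dilation c i) (Psi u) - fpscomp (s i - dilation c i) (Psi v)).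
    by rewrite /rhs !(fpscompB (psi u i)) //; ring.
  apply: order_geB; [apply: order_geD|].
  (* [psi u] and [psi v] have order 2 themselves, so their difference has order [max(d, 2)]. The
     maximum is needed because the estimate below subtracts one from the order, which fails for
     [d = 0]. *)
  - have od : order_ge (maxn d 2).-1.+1 (psi u i - psi v i).
      rewrite prednK; last by rewrite leq_max orbT.
      rewrite /maxn; case: ifP => _; last exact: psi_sub.
      by apply: order_geB; apply: psi_oge.
    apply: (@order_ge_le _ _ ((maxn d 2).-1 + 2)); first by rewrite /maxn; case: ifP; lia.
    apply: order_ge_comp_sub => // j.
    by rewrite /s' addrC addKr; apply: rho_oge.
  - rewrite -[d.+1]add1n; apply: (order_ge_comp_sub (a := 1)) => //; last exact: psi_oge.
    by move=> j; rewrite /s' opprD addrACA subrr add0r; apply: rho_sub.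
  rewrite -[d.+1]add1n; apply: (order_ge_comp_sub (a := 1)) => //.
  by move=> j; rewrite /Psi opprD addrACA subrr add0r; apply: psi_sub.
have [P0 S0] := (fixes0_Psi u2, fixes0_s' u2).
have lP : linear_part (Psi u) (fun=> 1).
  by move=> i; rewrite rmorph1 mul1r /Psi addrC addKr; apply: psi_oge.
have [Psi' PP _] := exists_inverse (fun=> oner_neq0 _) lP.
exists (Psi u), Psi', (s' u); split=> //.
- by move=> i; rewrite /s' addrC addKr; apply: rho_oge.
- move=> i; apply/eigenP => m; rewrite /s' fpscoefD !mulrDl; congr (_ + _).
    rewrite /dilation fpscoefCM fpscoefX; case: eqP => [->|]; last by rewrite mulr0 !mul0r.
    by rewrite cpowU.
  by rewrite /rho /res; case: eqP => [->|]; rewrite ?mul0r.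
apply: funext => i; rewrite /fmcomp.
have e : fpsC (c i) * psi u i - fpscomp (psi u i) (dilation c) - rho u i = rhs u i.
  apply: fpsP => m; rewrite !fpscoefB fpscoefCM fpscoef_dilation.
  have um : u i m = kap i m * rhs u i m by rewrite -{1}eu.
  rewrite /psi /rho; move: um; rewrite /kap /res; case: eqP => [->|/eqP ne] ->.
    by rewrite mul0r mulr0 subrr sub0r mulN1r opprK.
  rewrite subr0 mulrC -mulrBr [_^-1 * _]mulrC mulfVK // subr_eq0 eq_sym //.
have -> : s i = dilation c i + (s i - dilation c i) by rewrite addrC subrK.
rewrite fpscompD // [fpscomp (dilation c i) _](dilation_comp c i P0) {1 3}/Psi [fpscomp (_ + psi u i) _]fpscompD // fpscompX //.
move: e; rewrite /rhs; set A := fpscomp (psi u i) (s' u); set B := fpscomp _ (dilation c).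
set D := fpscomp _ (Psi u) => e.
have -> : D = A - B - (fpsC (c i) * psi u i - B - rho u i) by rewrite e; ring.
rewrite /s' /dilation; ring.
Qed.

End NormalForm.
End PoincareDulac.
#[export] Hint Resolve fixes0_dilation : core.

(** * Maps shifting the weights by a permutation *)

Section Weighted.
Variable R : realType.
Local Notation C := R[i].
Variable p : nat.
Local Notation I := 'I_(p + p).

Lemma xi_eta_ind (P : I -> Prop) :
  (forall j, P (lshift p j)) -> (forall j, P (rshift p j)) -> forall i, P i.
Proof. by move=> Pl Pr i; case: (split_ordP i) => j ->. Qed.

Definition base (i : I) : 'I_p := match split i with inl j => j | inr j => j end.
Definition swap (i : I) : I := match split i with inl j => rshift p j | inr j => lshift p j end.

Lemma split_lshift (j : 'I_p) : split (lshift p j) = inl j.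
Proof. exact: (unsplitK (inl j : 'I_p + 'I_p)). Qed.
Lemma split_rshift (j : 'I_p) : split (rshift p j) = inr j.
Proof. exact: (unsplitK (inr j : 'I_p + 'I_p)). Qed.

Lemma base_l j : base (lshift p j) = j. Proof. by rewrite /base split_lshift. Qed.
Lemma base_r j : base (rshift p j) = j. Proof. by rewrite /base split_rshift. Qed.
Lemma swap_l j : swap (lshift p j) = rshift p j. Proof. by rewrite /swap split_lshift. Qed.
Lemma swap_r j : swap (rshift p j) = lshift p j. Proof. by rewrite /swap split_rshift. Qed.
Definition baseE := (base_l, base_r, swap_l, swap_r).

Lemma swapK : involutive swap. Proof. by apply: xi_eta_ind => j; rewrite !baseE. Qed.
Lemma base_swap i : base (swap i) = base i.
Proof. by move: i; apply: xi_eta_ind => j; rewrite !baseE. Qed.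
Lemma swap_neq i : swap i != i.
Proof.
by move: i; apply: xi_eta_ind => j; rewrite !baseE; rewrite ?eq_lrshift ?eq_rlshift.
Qed.

Definition zeta : formal_map R (p + p) p := fun j => psX R (lshift p j) * psX R (rshift p j).

Lemma xietaE : @xieta R p = zeta.
Proof. by apply: funext => j; rewrite /xieta psmul_fpsmul. Qed.

Lemma fixes0_zeta : fixes0 zeta.
Proof. by move=> j; rewrite /zeta fpscoefM0 fpscoefX0 mul0r. Qed.
Local Hint Resolve fixes0_zeta : core.

Lemma psX_swap i : psX R i * psX R (swap i) = zeta (base i).
Proof. by move: i; apply: xi_eta_ind => j; rewrite !baseE // mulrC. Qed.

Definition sym_mnm (k : 'X_{1..p}) : 'X_{1..p + p} := [multinom k (base i) | i < p + p].
Definition xi_part (m : 'X_{1..p + p}) : 'X_{1..p} := [multinom m (lshift p j) | j < p].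

Lemma sym_mnmK k : xi_part (sym_mnm k) = k.
Proof. by apply/mnmP => j; rewrite !mnmE base_l. Qed.

Lemma mdeg_xi_part m : (mdeg (xi_part m) <= mdeg m)%N.
Proof.
rewrite !mdegE big_split_ord /= -[X in (X <= _)%N]addn0 leq_add //.
by apply: eq_leq; apply: eq_bigr => j _; rewrite mnmE.
Qed.

Lemma mmap1_zeta k : mmap1 zeta k = fps_of_mpoly 'X_[sym_mnm k].
Proof.
rewrite mpolyXE_id rmorph_prod big_split_ord /= -big_split /mmap1 /=; apply: eq_bigr => j _.
by rewrite !rmorphXn /= !fps_of_mpolyX !mnmE !baseE -exprMn.
Qed.

Lemma fpscoef_zeta (g : fps R p) m :
  fpscomp g zeta m = if m == sym_mnm (xi_part m) then g (xi_part m) else 0.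
Proof.
rewrite fpscompE fpsevalE fpscoef_sum.
under eq_bigr => k _ do rewrite fpscoefCM mmap1_zeta [fps_of_mpoly _ _]mcoeffX.
rewrite -[g (xi_part m)](pstruncE g (mdeg_xi_part m)); set q := pstrunc _ g.
transitivity (\sum_(k <- msupp q) q@_k * (k == xi_part m)%:R * (m == sym_mnm (xi_part m))%:R).
  apply: eq_bigr => k _; rewrite -mulrA -natrM mulnb; congr (_ * _%:R).
  congr nat_of_bool; apply/eqP/andP => [<-|[/eqP -> /eqP <-]] //.
  by rewrite sym_mnmK !eqxx.
rewrite -mulr_suml [in RHS](mpolyE q) raddf_sum /= (eq_bigr (fun k => (q@_k *: 'X_[k])@_(xi_part m))).
  by case: eqP => _; rewrite ?mulr1 ?mulr0.
by move=> k _; rewrite mcoeffZ mcoeffX.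
Qed.

Lemma fpscoef_zeta_sym (g : fps R p) k : fpscomp g zeta (sym_mnm k) = g k.
Proof. by rewrite fpscoef_zeta sym_mnmK eqxx. Qed.

Lemma fpscomp_zeta_inj (f g : fps R p) : fpscomp f zeta = fpscomp g zeta -> f = g.
Proof. by move=> e; apply: fpsP => k; rewrite -fpscoef_zeta_sym e fpscoef_zeta_sym. Qed.

(* x_i |-> c_i(xi eta) x_(w i). The normal forms of sigma, tau_i and rho are of this shape with
   w = id, swap, rho_perm (up to conjugation for rho), and so are all maps intertwining them. *)
Definition wform (c : I -> fps R p) (w : I -> I) : formal_map R (p + p) (p + p) :=
  fun i => fpscomp (c i) zeta * psX R (w i).

Definition base_map (w : I -> I) (j : 'I_p) : 'I_p := base (w (lshift p j)).

(* The map induced by wform c w on the products zeta_j = xi_j eta_j. *)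
Definition zeta_map (c : I -> fps R p) (w : I -> I) : formal_map R p p :=
  fun j => c (lshift p j) * c (rshift p j) * psX R (base_map w j).

Lemma fixes0_wform c w : fixes0 (wform c w).
Proof. by move=> i; rewrite /wform fpscoefM0 fpscoefX0 mulr0. Qed.
Lemma fixes0_zeta_map c w : fixes0 (zeta_map c w).
Proof. by move=> i; rewrite /zeta_map fpscoefM0 fpscoefX0 mulr0. Qed.
Local Hint Resolve fixes0_wform fixes0_zeta_map : core.

(** Pairs [(xi_j, eta_j)] go to pairs. Only then does [wform c w] send each product [zeta_j] to a
    series in [zeta]. *)
Definition swap_compat (w : I -> I) := forall i, w (swap i) = swap (w i).

Lemma base_map_base w i : swap_compat w -> base (w i) = base_map w (base i).
Proof.
by move=> ww; move: i; apply: xi_eta_ind => j; rewrite !baseE // /base_map -{1}swap_l ww base_swap.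
Qed.

Lemma zeta_wform c w : swap_compat w -> fmcomp zeta (wform c w) = fmcomp (zeta_map c w) zeta.
Proof.
move=> ww; apply: funext => j; rewrite /fmcomp /zeta /zeta_map fpscompM // !fpscompX //.
by rewrite /wform mulrACA -fpscompM // -{2}swap_l ww psX_swap [RHS]fpscompM // fpscompX.
Qed.

Lemma wform_comp c w c' w' : swap_compat w' ->
  fmcomp (wform c w) (wform c' w') =
  wform (fun i => fpscomp (c i) (zeta_map c' w') * c' (w i)) (w' \o w).
Proof.
move=> ww; apply: funext => i; rewrite /fmcomp {1}/wform fpscompM // fpscompX //.
by rewrite fpscompA // zeta_wform // -fpscompA // {1}/wform mulrA -fpscompM.
Qed.

(** Both sides are induced by the same map of the [(xi, eta)] space, and substitution of [zeta] is
    injective. *)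
Lemma zeta_map_comp c w c' w' : swap_compat w -> swap_compat w' ->
  fmcomp (zeta_map c w) (zeta_map c' w') =
  zeta_map (fun i => fpscomp (c i) (zeta_map c' w') * c' (w i)) (w' \o w).
Proof.
move=> ww ww'; apply: funext => j; apply: fpscomp_zeta_inj.
have sww : swap_compat (w' \o w) by move=> i; rewrite /= ww ww'.
have h := zeta_wform (fun i => fpscomp (c i) (zeta_map c' w') * c' (w i)) sww.
rewrite -[RHS]/(fmcomp (zeta_map _ _) zeta j) -h -wform_comp // -fmcompA // zeta_wform //.
rewrite fmcompA // zeta_wform // -fmcompA //.
Qed.

Lemma wform_inj c c' w : wform c w = wform c' w -> c = c'.
Proof.
move=> e; apply: funext => i; apply: fpscomp_zeta_inj; apply: (@mulX_inj _ _ _ _ (w i)).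
exact: (congr1 (fun F : formal_map R _ _ => F i) e).
Qed.

Lemma wform_id : wform (fun=> 1) id = @idmap R (p + p).
Proof. by apply: funext => i; rewrite /wform fpscomp1 // mul1r. Qed.

Lemma wform1 c w i j : wform c w i U_(j)%MM = c i 0%MM *+ (w i == j).
Proof.
rewrite /wform fpscoefMX mnm1E; have [->|ne] := eqVneq j (w i); last by rewrite mulr0n.
by rewrite /= -{1}[U_(_)%MM]add0m addmK fpscomp_at0 mulr1n.
Qed.

Lemma wformP w (F : formal_map R (p + p) (p + p)) :
  (forall i m, F i m != 0 -> exists k, m = (U_(w i) + sym_mnm k)%MM) ->
  exists c, F = wform c w.
Proof.
move=> FP; exists (fun i k => F i (U_(w i) + sym_mnm k)%MM); apply: funext => i.
apply: fpsP => m; rewrite /wform fpscoefMX fpscoef_zeta.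
have [F0|/FP[k ->]] := eqVneq (F i m) 0; last first.
  have -> : (U_(w i) + sym_mnm k - U_(w i))%MM = sym_mnm k by rewrite addmC addmK.
  by rewrite mnmDE mnm1E eqxx addn_eq0 /= sym_mnmK eqxx.
rewrite F0; case: eqP => // /eqP mw; case: eqP => // e; rewrite -e addmC submK //.
by rewrite lep1mP.
Qed.

(* Only the monomial relations forced by nu (swap i) = (nu i)^-1 hold. *)
Definition pair_nonresonant (nu : I -> C) := forall m m', cpow nu m = cpow nu m' ->
  forall i, (m i + m' (swap i) = m' i + m (swap i))%N.

(** Comparing [m] with the monomial [x_i] gives [m_i = m_(swap i) + 1] and equal exponents in every
    other pair. Hence the monomials resonant with [x_i] are the [x_i (xi eta)^k]. *)
Lemma pair_nonresonant_resonance nu i m : pair_nonresonant nu -> cpow nu m = nu i -> exists k, m = (U_(i) + sym_mnm k)%MM.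
Proof.
move=> nr; rewrite -[nu i]cpowU => /nr h.
have im : (U_(i) <= m)%MM.
  rewrite lep1mP; have := h i; rewrite !mnm1E eqxx eq_sym (negbTE (swap_neq i)); lia.
exists (xi_part (m - U_(i))); rewrite -{1}(submK im) addmC; congr (_ + _)%MM.
set m1 := (m - _)%MM; apply/mnmP => j.
have -> : sym_mnm (xi_part m1) j = m1 (lshift p (base j)) by rewrite !mnmE.
suff e j' : m1 j' = m1 (swap j').
  by move: j; apply: xi_eta_ind => j; rewrite !baseE //; rewrite e baseE.
rewrite /m1 !mnmBE; have := h j'; have := h i; rewrite !mnm1E.
have := swap_neq i; have := swap_neq j'.
have [<-|ij'] := eqVneq i j'.
  by rewrite eqxx eq_sym => /negbTE->; lia.
have [e|isj] := eqVneq i (swap j'); last lia.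
by rewrite e swapK eqxx eq_sym; lia.
Qed.

(** If [nu i = nu j], then [x_j] is resonant with [x_i] and is therefore divisible by it. *)
Lemma pair_nonresonant_inj nu : pair_nonresonant nu -> injective nu.
Proof.
move=> nr i j e; have := pair_nonresonant_resonance nr (_ : cpow nu U_(j)%MM = nu i).
rewrite cpowU => /(_ (esym e)) [k /mnmP/(_ i)]; rewrite mnmDE !mnm1E eqxx.
by case: eqP => // ->.
Qed.

Lemma pair_nonresonant_conj nu : pair_nonresonant nu -> pair_nonresonant (fun i => (nu i)^*).
Proof.
by move=> nr m m'; rewrite -!cpow_conj => /(can_inj (@conjcK R))/nr.
Qed.

(** Equivariance leaves in component [i] only the monomials resonant with [x_(w i)]. *)
Lemma equivariant_wform c1 c2 w (F : formal_map R (p + p) (p + p)) :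
  pair_nonresonant c2 -> (forall i, c1 i = c2 (w i)) -> equivariant c1 c2 F ->
  exists c, F = wform c w.
Proof.
move=> nr c12 eF; apply: wformP => i m Fm; apply: (pair_nonresonant_resonance nr).
have /eigenP/(_ m)/eqP := eF i.
by rewrite -subr_eq0 -mulrBr mulf_eq0 (negbTE Fm) /= subr_eq0 c12 => /eqP.
Qed.

Lemma wform_equivariant c1 c2 w c : (forall i, c2 (swap i) = (c2 i)^-1) -> (forall i, c2 i != 0) ->
  (forall i, c1 i = c2 (w i)) -> equivariant c1 c2 (wform c w).
Proof.
move=> c2V c20 c12 i; rewrite /eigen /wform fpscompM // fpscompX // fpscompA //.
have -> : fmcomp zeta (dilation c2) = zeta.
  apply: funext => j; rewrite /fmcomp /zeta fpscompM // !fpscompX // /dilation mulrACA -rmorphM.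
  by rewrite -swap_l c2V mulfV // rmorph1 mul1r.
by rewrite /dilation mulrCA c12.
Qed.

Definition spectrum (mu : 'I_p -> C) : I -> C :=
  fun i => match split i with inl j => mu j | inr j => (mu j)^-1 end.

Lemma spectrum_l mu j : spectrum mu (lshift p j) = mu j.
Proof. by rewrite /spectrum split_lshift. Qed.
Lemma spectrum_r mu j : spectrum mu (rshift p j) = (mu j)^-1.
Proof. by rewrite /spectrum split_rshift. Qed.
Lemma spectrum_swap mu i : spectrum mu (swap i) = (spectrum mu i)^-1.
Proof. by move: i; apply: xi_eta_ind => j; rewrite !baseE ?spectrum_l ?spectrum_r // invrK. Qed.
Lemma spectrum_neq0 mu i : (forall j, mu j != 0) -> spectrum mu i != 0.
Proof. by move=> mu0; move: i; apply: xi_eta_ind => j; rewrite ?spectrum_l ?spectrum_r ?invr_eq0. Qed.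

(** The quotient of the two powers is [mu^Q], where [Q_j] is the [xi_j] exponent minus the [eta_j]
    exponent in [m], less the same difference in [m']. *)
Lemma nonresonant_pair mu : (forall j, mu j != 0) -> nonresonant mu -> pair_nonresonant (spectrum mu).
Proof.
move=> mu0 nr m m' e.
pose Q : 'rV[int]_p := \row_j ((m (lshift p j))%:Z - (m (rshift p j))%:Z
   - ((m' (lshift p j))%:Z - (m' (rshift p j))%:Z)).
have cE k : cpow (spectrum mu) k =
    \prod_j mu j ^ ((k (lshift p j))%:Z - (k (rshift p j))%:Z).
  rewrite /cpow big_split_ord /= -big_split /=; apply: eq_bigr => j _.
  by rewrite spectrum_l spectrum_r expfzDr // -exprz_inv.
have Q0 : Q = 0.
  apply/eqP; apply: contraTT isT => /nr /negP[]; apply/eqP.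
  transitivity (cpow (spectrum mu) m / cpow (spectrum mu) m').
    rewrite !cE -prodf_div; apply: eq_bigr => j _.
    by rewrite mxE expfzDr // [in RHS]invr_expz.
  rewrite e divff // cE; apply/prodf_neq0 => j _; exact: expfz_neq0.
have h j : (m (lshift p j) + m' (rshift p j) = m' (lshift p j) + m (rshift p j))%N.
  have /eqP := congr1 (fun A : 'rV[int]_p => A 0 j) Q0; rewrite !mxE; lia.
by apply: xi_eta_ind => j; rewrite baseE; have := h j; lia.
Qed.

End Weighted.
#[export] Hint Resolve fixes0_zeta fixes0_wform fixes0_zeta_map : core.

(** * Coefficient families of sigma and tau *)

Section StandardForms.
Variable R : realType.
Local Notation C := R[i].
Variable p : nat.
Local Notation I := 'I_(p + p).

Definition inv_pair (L : formal_map R p p) : I -> fps R p :=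
  fun i => match split i with inl j => L j | inr j => fpsinv (L j) end.

Lemma inv_pair_l L j : inv_pair L (lshift p j) = L j. Proof. by rewrite /inv_pair split_lshift. Qed.
Lemma inv_pair_r L j : inv_pair L (rshift p j) = fpsinv (L j). Proof. by rewrite /inv_pair split_rshift. Qed.

Lemma inv_pair_swap L i : (forall j, L j 0%MM != 0) -> inv_pair L i * inv_pair L (swap i) = 1.
Proof.
move=> L0; move: i; apply: xi_eta_ind => j; rewrite !baseE inv_pair_l inv_pair_r; last rewrite mulrC.
all: exact: fpsinvP.
Qed.

Lemma inv_pairP (c : I -> fps R p) : (forall i, c i * c (swap i) = 1) ->
  c = inv_pair (fun j => c (lshift p j)).
Proof.
move=> cV; apply: funext; apply: xi_eta_ind => j; rewrite ?inv_pair_l ?inv_pair_r //.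
by apply: fpsinv_unique; rewrite -swap_l.
Qed.

Lemma pscomp_xieta (f : fps R p) : pscomp f (@xieta R p) = fpscomp f (@zeta R p).
Proof. by rewrite pscomp_fpscomp xietaE. Qed.

Lemma sigma_formE (M : formal_map R p p) : sigma_form M = Hol (wform (inv_pair M) id).
Proof.
congr Hol; apply: funext; apply: xi_eta_ind => j; rewrite /wform.
  by rewrite split_lshift inv_pair_l psmul_fpsmul pscomp_xieta.
by rewrite split_rshift inv_pair_r psmul_fpsmul pscomp_xieta psinv_fpsinv.
Qed.

Lemma tau_formE (L : formal_map R p p) : tau_form L = Hol (wform (inv_pair L) (@swap p)).
Proof.
congr Hol; apply: funext; apply: xi_eta_ind => j; rewrite /wform !baseE.
  by rewrite split_lshift inv_pair_l psmul_fpsmul pscomp_xieta.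
by rewrite split_rshift inv_pair_r psmul_fpsmul pscomp_xieta psinv_fpsinv.
Qed.

Lemma mconjE n k (F : formal_map R n k) i : mconj F i = fpsconj (F i).
Proof. by []. Qed.

Lemma mconj_zeta : mconj (@zeta R p) = @zeta R p.
Proof. by apply: funext => j; rewrite mconjE /zeta rmorphM /= !fpsconjX. Qed.

Lemma mconj_wform (c : I -> fps R p) w : mconj (wform c w) = wform (fun i => fpsconj (c i)) w.
Proof.
apply: funext => i; rewrite mconjE /wform rmorphM /= fpsconjX fpsconj_comp //.
by rewrite mconj_zeta.
Qed.

Lemma mconj_zeta_map (c : I -> fps R p) w : mconj (zeta_map c w) = zeta_map (fun i => fpsconj (c i)) w.
Proof. by apply: funext => i; rewrite mconjE /zeta_map !rmorphM /= fpsconjX. Qed.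

(** Maps in the form of [sigma_form] or [tau_form] leave every [zeta_j] invariant, so composing on
    the right with them substitutes nothing into the coefficients. *)
Lemma zeta_map_unit (c : I -> fps R p) w : (forall i, c i * c (swap i) = 1) ->
  base_map w =1 id -> zeta_map c w = @idmap R p.
Proof. by move=> cV bw; apply: funext => j; rewrite /zeta_map -swap_l cV mul1r bw. Qed.

Lemma base_map_swap : base_map (@swap p) =1 id. Proof. by move=> j; rewrite /base_map !baseE. Qed.
Lemma base_map_id : base_map (@id I) =1 id. Proof. by move=> j; rewrite /base_map !baseE. Qed.
Lemma swap_compat_swap : swap_compat (@swap p). Proof. by []. Qed.
Lemma swap_compat_id : swap_compat (@id I). Proof. by []. Qed.

(** For [a = A - id], the relation [A o A = id] gives [a o A = - a]. But [a o A] agrees with [a] to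
    one order more than the order of [a], so [2 a] vanishes to that higher order, and so on. *)
Lemma tangent_involution n (A : formal_map R n n) :
  linear_part A (fun=> 1) -> fmcomp A A = @idmap R n -> A = @idmap R n.
Proof.
move=> lA AA; have A0 := linear_part0 lA; have i0 := @fixes0_id R n.
have lA' i : order_ge 2 (A i - psX R i) by have := lA i; rewrite rmorph1 mul1r.
suff H d : forall i, order_ge d.+2 (A i - psX R i).
  by apply: funext => i; apply: order_ge_eq => -[|[|d]]; [apply: order_ge_zero | apply: order_ge_le (lA' i) |].
elim: d => // d IH i.
have e : fpscomp (A i - psX R i) A - fpscomp (A i - psX R i) (@idmap R n) =
   - 2 * (A i - psX R i).
  have := congr1 (fun F : formal_map R n n => F i) AA; rewrite /fmcomp /idmap => AAi.
  by rewrite fpscomp_id fpscompB // AAi fpscompX //; ring.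
have o : order_ge d.+3 (- 2 * (A i - psX R i)).
  by rewrite -e -addn2; apply: (order_ge_comp_sub (a := d.+1)).
move=> m lm; have := o m lm.
have -> : (- 2 : fps R n) = fpsC (- 2) by rewrite rmorphN rmorph_nat.
by rewrite fpscoefCM => /eqP; rewrite mulf_eq0 oppr_eq0 pnatr_eq0 /= => /eqP.
Qed.

Lemma linear_part_zeta_map (c : I -> fps R p) w : base_map w =1 id ->
  linear_part (zeta_map c w) (fun j => c (lshift p j) 0%MM * c (rshift p j) 0%MM).
Proof.
move=> bw j; rewrite /zeta_map bw -mulrBl; rewrite -[2%N]addn1; apply: order_geM; last exact: order_geX.
by apply/order_ge1P; rewrite fpscoefB fpscoefC eqxx fpscoefM0 subrr.
Qed.

Lemma linear_part_wform (c : I -> fps R p) : linear_part (wform c id) (fun i => c i 0%MM).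
Proof.
move=> j; rewrite /wform -mulrBl; rewrite -[2%N]addn1; apply: order_geM; last exact: order_geX.
by apply/order_ge1P; rewrite fpscoefB fpscoefC eqxx fpscomp_at0 subrr.
Qed.

(** Squaring gives [l_i(A) l_(swap i) = 1], where [A] is the map induced on [zeta]. At the origin
    this makes [A] tangent to the identity; being an involution, [A] is then the identity and drops
    out of the relation. *)
Lemma swap_involution (l : I -> fps R p) :
  fmcomp (wform l (@swap p)) (wform l (@swap p)) = @idmap R (p + p) -> forall i, l i * l (swap i) = 1.
Proof.
rewrite wform_comp // => e.
have e' : wform (fun i => fpscomp (l i) (zeta_map l (@swap p)) * l (swap i)) id = wform (fun=> 1) id.
  by rewrite wform_id -[RHS]e; congr wform; apply: funext => i /=; rewrite swapK.
have l1 i : fpscomp (l i) (zeta_map l (@swap p)) * l (swap i) = 1.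
  exact: (congr1 (fun c : I -> fps R p => c i) (wform_inj e')).
have l10 i : l i 0%MM * l (swap i) 0%MM = 1.
  by have := congr1 (fun f : fps R p => f 0%MM) (l1 i); rewrite fpscoefM0 fpscomp_at0 fpscoef1 eqxx.
suff A1 : zeta_map l (@swap p) = @idmap R p by move=> i; rewrite -[RHS](l1 i) A1 fpscomp_id.
apply: tangent_involution.
  move=> j; have := linear_part_zeta_map l base_map_swap j.
  by have := l10 (lshift p j); rewrite swap_l => ->.
rewrite zeta_map_comp //; apply: funext => j; rewrite /zeta_map !l1 mulr1 mul1r.
by rewrite /base_map /= swapK base_l.
Qed.

End StandardForms.

(** * The standard involution and the spectrum *)

Section StandardRho.
Variable R : realType.
Local Notation C := R[i].
Variables es hs ss p : nat.
Local Notation I := 'I_(p + p).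
Hypothesis eP : (es + hs + 2 * ss)%N = p.

Local Notation partner := (@partner es hs ss p).

Lemma partner_val (j : 'I_p) : partner j = (if (j < es + hs)%N then (j : nat)
  else if (j < p - ss)%N then j + ss else j - ss)%N :> nat.
Proof.
rewrite /partner; case: ifP => // h1; case: ifP => h2; rewrite val_insubd.
  by case: ifP => //; lia.
by case: ifP => //; have := ltn_ord j; lia.
Qed.

Lemma partnerK : involutive partner.
Proof.
move=> j; apply: val_inj; rewrite /= !partner_val; have := ltn_ord j.
by do ![case: ifP]; lia.
Qed.

Lemma partner_es (j : 'I_p) : (partner j < es)%N = (j < es)%N.
Proof. by rewrite partner_val; do ![case: ifP]; lia. Qed.

Lemma partner_id (j : 'I_p) : (j < es)%N -> partner j = j.
Proof. by move=> je; apply: val_inj; rewrite /= partner_val; case: ifP; lia. Qed.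

Definition rho_perm (i : I) : I := match split i with
  | inl j => if (j < es)%N then rshift p j else lshift p (partner j)
  | inr j => if (j < es)%N then lshift p j else rshift p (partner j)
  end.

Lemma rho_perm_l j : rho_perm (lshift p j) = if (j < es)%N then rshift p j else lshift p (partner j).
Proof. by rewrite /rho_perm split_lshift. Qed.
Lemma rho_perm_r j : rho_perm (rshift p j) = if (j < es)%N then lshift p j else rshift p (partner j).
Proof. by rewrite /rho_perm split_rshift. Qed.

Lemma rho_permK : involutive rho_perm.
Proof.
apply: xi_eta_ind => j; rewrite ?rho_perm_l ?rho_perm_r; case: ifP => h; rewrite ?rho_perm_l ?rho_perm_r ?h //.
all: by rewrite partner_es h partnerK.
Qed.

Lemma swap_compat_rho_perm : swap_compat rho_perm.
Proof. by apply: xi_eta_ind => j; rewrite !baseE rho_perm_l rho_perm_r; case: ifP => h; rewrite baseE. Qed.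

Lemma base_map_rho_perm j : base_map rho_perm j = partner j.
Proof. by rewrite /base_map rho_perm_l; case: ifP => h; rewrite baseE // partner_id. Qed.

Lemma std_rhoE : std_rho R es hs ss p = Anti (wform (fun=> 1) rho_perm).
Proof.
congr Anti; apply: funext; apply: xi_eta_ind => j; rewrite /wform fpscomp1 // mul1r.
  by rewrite split_lshift rho_perm_l; case: ifP.
by rewrite split_rshift rho_perm_r; case: ifP.
Qed.

Variables lam mu : 'I_p -> C.
Hypothesis hlam : eigenvalues_normalized es hs ss lam mu.

Lemma lam_neq0 j : lam j != 0.
Proof.
case: hlam => _ he hh hs' hp.
have [je|je] := ltnP j es; first by rewrite gt_eqF // (lt_trans ltr01) // he.
have [jh|jh] := ltnP j (es + hs).
  by have [|n1 _] := hh j; rewrite ?je // -normr_eq0 n1 oner_eq0.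
have s0 (k : 'I_p) : (es + hs <= k < p - ss)%N -> lam k != 0.
  by move=> /hs'[l1 _]; rewrite -normr_eq0 gt_eqF // (lt_trans ltr01).
have [js|js] := ltnP j (p - ss); first by apply: s0; rewrite jh.
have jp := ltn_ord j.
have kp : (j - ss < p)%N by lia.
rewrite (hp (Ordinal kp) j) /=; [|lia|lia].
by rewrite invr_eq0 conjc_eq0 s0 //=; lia.
Qed.

Lemma mu_neq0 j : mu j != 0.
Proof. by case: hlam => -> *; rewrite expf_neq0 // lam_neq0. Qed.

Lemma mu_real (j : 'I_p) : (j < es)%N -> (mu j)^* = mu j.
Proof.
case: hlam => -> he _ _ _ /he l1; rewrite rmorphXn; congr (_ ^+ 2).
have : 0 <= lam j by rewrite ltW // (lt_trans ltr01).
by case: (lam j) => a b; rewrite lecE /= => /andP[/eqP -> _]; rewrite oppr0.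
Qed.

Lemma mu_partner (j : 'I_p) : (es <= j)%N -> (mu (partner j))^* = (mu j)^-1.
Proof.
case: hlam => mE _ hh _ hp je; rewrite !mE rmorphXn -exprVn; congr (_ ^+ 2).
have [jh|jh] := ltnP j (es + hs).
  have -> : partner j = j by apply: val_inj; rewrite /= partner_val jh.
  have [|n1 _] := hh j; first by rewrite je.
  apply: (mulfI (lam_neq0 j)); rewrite mulfV ?lam_neq0 //.
  by have := sqr_normc (lam j); rewrite n1 expr1n.
have [js|js] := ltnP j (p - ss).
  rewrite (hp j (partner j)) ?jh //; first by rewrite fmorphV /= conjcK.
  by rewrite partner_val js ltnNge jh.
rewrite (hp (partner j) j) ?invrK // partner_val; have := ltn_ord j; do ![case: ifP]; lia.
Qed.

(** For the diagonal linear part [S] this is [rho S rho = S^-1]: [mu_j] is real for elliptic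
    indices, of modulus 1 for hyperbolic ones, and inverse to the conjugate of its partner for
    complex ones. It is what selects [rho_perm] as the index map of [rho]. *)
Lemma spectrum_rho_perm i : (spectrum mu i)^-1 = (spectrum mu (rho_perm i))^*.
Proof.
move: i; apply: xi_eta_ind => j; rewrite ?rho_perm_l ?rho_perm_r; case: (ltnP j es) => h;
  rewrite ?spectrum_l ?spectrum_r ?invrK.
- by rewrite fmorphV /= mu_real.
- by rewrite mu_partner.
- by rewrite mu_real.
by rewrite fmorphV /= mu_partner // invrK.
Qed.

End StandardRho.

(** * Existence of the normal form *)

Section EquivarianceMore.
Variable R : realType.
Local Notation C := R[i].
Variable n : nat.
Implicit Types (c : 'I_n -> C) (F G : formal_map R n n).

Lemma cpowV c m : cpow (fun i => (c i)^-1) m = (cpow c m)^-1.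
Proof. by rewrite /cpow -prodfV; apply: eq_bigr => i _; rewrite exprVn. Qed.

(** Every monomial that occurs satisfies [c2^m = c1_i], and inverting both sides preserves this. *)
Lemma equivariantV c1 c2 F : equivariant c1 c2 F ->
  equivariant (fun i => (c1 i)^-1) (fun i => (c2 i)^-1) F.
Proof.
move=> e i; apply/eigenP => m; rewrite cpowV; have /eigenP/(_ m)/eqP := e i.
rewrite -subr_eq0 -mulrBr mulf_eq0 subr_eq0 => /orP[/eqP->|/eqP->] //.
by rewrite !mul0r.
Qed.

Lemma equivariant_mconj c1 c2 F : equivariant c1 c2 F ->
  equivariant (fun i => (c1 i)^*) (fun i => (c2 i)^*) (mconj F).
Proof.
move=> e i; apply/eigenP => m; rewrite -cpow_conj -!rmorphM; congr (_^*).
by have /eigenP := e i; apply.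
Qed.

Lemma linear_part_mconj c F : linear_part F c -> linear_part (mconj F) (fun i => (c i)^*).
Proof.
move=> l i; have := order_ge_conj (l i).
by rewrite rmorphB rmorphM /= fpsconjC fpsconjX.
Qed.

Lemma formal_inverse_unique F G H : formal_inverse F G -> formal_inverse F H -> G = H.
Proof.
move=> /formal_inverseE[F0 G0 FG GF] /formal_inverseE[_ H0 FH HF].
by rewrite -[LHS]fmcompf1 -FH -fmcompA // GF fmcomp1f.
Qed.

Lemma linear_part_inv c F G : (forall i, c i != 0) -> formal_inverse F G ->
  linear_part F c -> linear_part G (fun i => (c i)^-1).
Proof.
move=> c0 FG l; have [H FH lH] := exists_inverse c0 l.
by rewrite (formal_inverse_unique FG FH).
Qed.

End EquivarianceMore.

Section PartOne.
Variable R : realType.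
Local Notation C := R[i].
Variables es hs ss p : nat.
Local Notation I := 'I_(p + p).
Local Notation fmap := (formal_map R (p + p) (p + p)).
Hypothesis eP : (es + hs + 2 * ss)%N = p.
Local Notation rho_perm := (@rho_perm es hs ss p).

Lemma hol_comp (F G : fmap) : scomp (Hol F) (Hol G) = Hol (fmcomp F G).
Proof. by rewrite /= fmcompE. Qed.
Lemma hol_anti_comp (F G : fmap) : scomp (Hol F) (Anti G) = Anti (fmcomp F G).
Proof. by rewrite /= fmcompE. Qed.
Lemma anti_hol_comp (F G : fmap) : scomp (Anti F) (Hol G) = Anti (fmcomp F (mconj G)).
Proof. by rewrite /= fmcompE. Qed.
Lemma anti_comp (F G : fmap) : scomp (Anti F) (Anti G) = Hol (fmcomp F (mconj G)).
Proof. by rewrite /= fmcompE. Qed.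

Lemma Hol_inj : injective (@Hol R (p + p)). Proof. by move=> F G []. Qed.
Lemma Anti_inj : injective (@Anti R (p + p)). Proof. by move=> F G []. Qed.

Lemma conjugate_Hol (Psi Psi' F : fmap) :
  conjugate Psi Psi' (Hol F) = Hol (fmcomp Psi' (fmcomp F Psi)).
Proof. by rewrite /conjugate !hol_comp. Qed.
Lemma conjugate_Anti (Psi Psi' F : fmap) :
  conjugate Psi Psi' (Anti F) = Anti (fmcomp Psi' (fmcomp F (mconj Psi))).
Proof. by rewrite /conjugate anti_hol_comp hol_anti_comp. Qed.

(** Gathers the relations that survive formal conjugation, to be carried through the successive
    changes of coordinates. *)
Record reversible (r s t1 t2 : selfmap R (p + p)) : Prop := Reversible {
  rev_r0 : sfix r; rev_s0 : sfix s; rev_t10 : sfix t1; rev_t20 : sfix t2;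
  rev_rr : scomp r r = sid R (p + p);
  rev_t1 : scomp t1 t1 = sid R (p + p);
  rev_t2 : t2 = scomp r (scomp t1 r);
  rev_s : s = scomp t1 t2 }.

Lemma reversible_conjugate Psi Psi' r s t1 t2 : formal_inverse Psi Psi' ->
  reversible r s t1 t2 ->
  reversible (conjugate Psi Psi' r) (conjugate Psi Psi' s)
    (conjugate Psi Psi' t1) (conjugate Psi Psi' t2).
Proof.
move=> PV [r0 s0 t10 t20 rr t11 t2E sE].
have tr : sfix (scomp t1 r) by apply: sfix_comp.
split; try exact: conjugate_fix.
- by rewrite -(conjugate_comp PV r0 r0) rr (conjugate_id PV).
- by rewrite -(conjugate_comp PV t10 t10) t11 (conjugate_id PV).
- by rewrite {1}t2E (conjugate_comp PV r0 tr) (conjugate_comp PV t10 r0).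
by rewrite {1}sE (conjugate_comp PV t10 t20).
Qed.

Section Relations.
Variables r s t1 t2 : selfmap R (p + p).
Hypothesis H : reversible r s t1 t2.
Let s' := scomp t2 t1.

Lemma rev_t2t2 : scomp t2 t2 = sid R (p + p).
Proof.
case: H => r0 s0 t10 t20 rr t11 t2E sE.
have tr : sfix (scomp t1 r) by apply: sfix_comp.
rewrite t2E (scompA r tr) -?t2E // t2E (scompA t1 r0); last exact: sfix_comp.
rewrite -(scompA r r0 tr) rr (scomp1f tr) -(scompA t1 t10 r0) t11 (scomp1f r0).
exact: rr.
Qed.

Lemma rev_inv : scomp s s' = sid R (p + p) /\ scomp s' s = sid R (p + p).
Proof.
have t22 := rev_t2t2; case: H => r0 s0 t10 t20 rr t11 t2E sE.
have ts' : sfix (scomp t2 t1) by apply: sfix_comp.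
have ts : sfix (scomp t1 t2) by apply: sfix_comp.
split; rewrite /s' sE.
  by rewrite (scompA t1 t20 ts') -(scompA t2 t20 t10) t22 (scomp1f t10).
by rewrite (scompA t2 t10 ts) -(scompA t1 t10 t20) t11 (scomp1f t20).
Qed.

Lemma rev_t1s : scomp t1 s = scomp s' t1.
Proof.
case: H => r0 s0 t10 t20 rr t11 t2E sE.
by rewrite /s' sE -(scompA t1 t10 t20) t11 (scomp1f t20) (scompA t2 t10 t10) t11 scompf1.
Qed.

Lemma rev_t2s : scomp t2 s = scomp s' t2.
Proof. by case: H => r0 s0 t10 t20 rr t11 t2E sE; rewrite /s' sE (scompA t2 t10 t20). Qed.

Lemma rev_rs : scomp r s = scomp s' r.
Proof.
case: H => r0 s0 t10 t20 rr t11 t2E sE.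
have t1r : sfix (scomp t1 r) by apply: sfix_comp.
have rt1r : sfix (scomp r (scomp t1 r)) by apply: sfix_comp.
have t1r0 : sfix (scomp t1 t2) by apply: sfix_comp.
rewrite /s' sE (scompA t2 t10 r0) t2E (scompA r t1r t1r) (scompA t1 r0 t1r) //.
Qed.

End Relations.

(* rho_conj f (zeta) = (f (rho zeta))^*, rho being the involution induced on zeta. *)
Definition rho_conj (f : fps R p) : fps R p := fpscomp (fpsconj f) (zeta_map (fun=> 1) rho_perm).

(** The last two relations are [sigma = tau_1 tau_2] and [tau_2 = rho tau_1 rho] read on
    coefficients. The first involves no substitution because [tau_2] fixes every [zeta_j]. *)
Lemma standard_relations (m l1 l2 : I -> fps R p) :
  reversible (Anti (wform (fun=> 1) rho_perm)) (Hol (wform m id))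
    (Hol (wform l1 (@swap p))) (Hol (wform l2 (@swap p))) ->
  [/\ forall i, l1 i * l1 (swap i) = 1, forall i, l2 i * l2 (swap i) = 1,
      forall i, m i = l1 i * l2 (swap i) & forall i, l2 i = rho_conj (l1 (rho_perm i))].
Proof.
have ws := @swap_compat_rho_perm es hs ss p; have sK := @rho_permK es hs ss p eP.
move=> H; have l1V : forall i, l1 i * l1 (swap i) = 1.
  by apply: swap_involution; apply: Hol_inj; rewrite -hol_comp; exact: rev_t1 H.
have l2V : forall i, l2 i * l2 (swap i) = 1.
  by apply: swap_involution; apply: Hol_inj; rewrite -hol_comp; exact: rev_t2t2 H.
split=> //.
  have := rev_s H; rewrite hol_comp (wform_comp _ _ _ (@swap_compat_swap p)) => /Hol_inj e i.
  have e' : wform m id = wform (fun i => fpscomp (l1 i) (zeta_map l2 (@swap p)) * l2 (swap i)) id.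
    by rewrite e; congr wform; apply: funext => k /=; rewrite swapK.
  have := congr1 (fun c : I -> fps R p => c i) (wform_inj e') => -> /=.
  by rewrite (zeta_map_unit l2V (@base_map_swap p)) fpscomp_id.
have := rev_t2 H; rewrite hol_anti_comp anti_comp (wform_comp _ _ _ ws) mconj_wform.
have wss : swap_compat (rho_perm \o @swap p) by move=> i; rewrite /= ws.
rewrite (wform_comp _ _ _ wss) => /Hol_inj.
have -> : (rho_perm \o @swap p) \o rho_perm = @swap p by apply: funext => k; rewrite /= ws sK.
move=> /wform_inj e i; rewrite e fpscomp1; last exact: fixes0_zeta_map.
rewrite mul1r mulr1 fpsconj_comp //.
by rewrite mconj_zeta_map /rho_conj; congr (fpscomp _ (zeta_map _ _)); apply: funext => k; rewrite rmorph1.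
Qed.

Variables (lam mu : 'I_p -> C).
Hypothesis hlam : eigenvalues_normalized es hs ss lam mu.
Hypothesis hmu : nonresonant mu.
Let mu0 j : mu j != 0. Proof. exact: (mu_neq0 eP hlam). Qed.
Let nu := spectrum mu.
Let nu0 i : nu i != 0. Proof. exact: spectrum_neq0. Qed.
Let nuN : pair_nonresonant nu. Proof. exact: nonresonant_pair. Qed.

(** As [rho] is anti-holomorphic, its series intertwines the inverse of [s] with the conjugate of
    [s]; hence the conjugate weights. *)
Lemma normalized_relations (rho s t1 t2 : fmap) :
  reversible (Anti rho) (Hol s) (Hol t1) (Hol t2) ->
  linear_part s nu -> equivariant nu nu s ->
  [/\ equivariant (fun i => (nu i)^-1) nu t1,
      equivariant (fun i => (nu i)^-1) nu t2
    & equivariant (fun i => (nu i)^-1) (fun i => (nu i)^*) rho].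
Proof.
move=> H ls es'; have [r0 s0 t10 t20 _ _ _ _] := H.
have [e1 e2] := rev_inv H; rewrite !hol_comp in e1 e2.
have sV : formal_inverse s (fmcomp t2 t1).
  by apply/formal_inverseE; split=> //; [apply: fixes0_comp | apply: Hol_inj | apply: Hol_inj].
have lV := linear_part_inv nu0 sV ls.
have eV := equivariantV (equivariant_inv sV es').
split.
- apply: (intertwine_linear t10 lV ls eV es').
  by apply: Hol_inj; have := rev_t1s H; rewrite !hol_comp.
- apply: (intertwine_linear t20 lV ls eV es').
  by apply: Hol_inj; have := rev_t2s H; rewrite !hol_comp.
apply: (intertwine_linear r0 lV (linear_part_mconj ls) eV (equivariant_mconj es')).
by apply: Anti_inj; have := rev_rs H; rewrite !hol_comp hol_anti_comp anti_hol_comp.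
Qed.

(* Cartan's averaging: [wform theta id] is T + rho_0 T rho, where rho_0 is the standard
   involution and T the dilation by t; the choice of t keeps theta(0) nonzero. *)
Lemma rectify_rho (r : I -> fps R p) :
  fmcomp (wform r rho_perm) (mconj (wform r rho_perm)) = @idmap R (p + p) ->
  exists2 theta : I -> fps R p, forall i, theta i 0%MM != 0 &
    fmcomp (wform theta id) (wform r rho_perm) = fmcomp (wform (fun=> 1) rho_perm) (mconj (wform theta id)).
Proof.
have ws := @swap_compat_rho_perm es hs ss p; have sK := @rho_permK es hs ss p eP.
rewrite mconj_wform (wform_comp _ _ _ ws) => rr.
set A := zeta_map _ _ in rr.
have e1 i : fpscomp (r i) A * fpsconj (r (rho_perm i)) = 1.
  have e' : wform (fun i => fpscomp (r i) A * fpsconj (r (rho_perm i))) id = wform (fun=> 1) id.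
    by rewrite wform_id -[RHS]rr; congr wform; apply: funext => j /=; rewrite sK.
  exact: (congr1 (fun c : I -> fps R p => c i) (wform_inj e')).
have A0 : fixes0 A by exact: fixes0_zeta_map.
have k1 i : r i 0%MM * conjc (r (rho_perm i) 0%MM) = 1.
  by have := congr1 (fun f : fps R p => f 0%MM) (e1 i); rewrite fpscoefM0 fpscomp_at0 fpscoef1 eqxx.
(* When [rho_perm] exchanges two indices, one gets 1 and the other 0, so a single summand of [theta]
   survives at 0. At a fixed index the value is [t + conj(t) conj(r(0))]: [t = 1] works unless
   [conj(r(0)) = -1], and then [t = i] gives [2 i]. *)
pose t (i : I) : C := if (i < rho_perm i)%N then 1 else if rho_perm i == i then
  (if conjc (r i 0%MM) == -1 then 'i else 1) else 0.
pose theta (i : I) : fps R p := fpsC (t i) + fpsC (conjc (t (rho_perm i))) * fpsconj (r (rho_perm i)).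
exists theta => [i|].
  rewrite /theta fpscoefD fpscoefC eqxx fpscoefCM -[fpsconj _ _]/(conjc (r (rho_perm i) 0%MM)).
  have k0 : conjc (r (rho_perm i) 0%MM) != 0.
    by apply/eqP => k0; have /eqP := k1 i; rewrite k0 mulr0 eq_sym oner_eq0.
  have [si|si] := eqVneq (rho_perm i) i.
    rewrite /t !si !ltnn !eqxx.
    have [e|ne] := eqVneq (conjc (r i 0%MM)) (-1); last first.
      by rewrite conjc1 mul1r addrC -[1 *+ _]opprK subr_eq0.
    have -> : conjc ('i%C : C) = - 'i%C by apply/eqP; rewrite eq_complex /= oppr0 !eqxx.
    by rewrite e mulrN1 opprK -mulr2n mulrn_eq0 /= eq_complex /= oner_eq0 andbF.
  have si' : (i == rho_perm i) = false by rewrite eq_sym (negbTE si).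
  have [lt|ge] := ltnP i (rho_perm i).
    rewrite /t lt sK [(rho_perm i < i)%N]ltnNge (ltnW lt) /= ?si' ?(negbTE si).
    by rewrite conjc0 mul0r addr0 oner_eq0.
  have lt : (rho_perm i < i)%N by rewrite ltn_neqAle si.
  have nlt : (i < rho_perm i)%N = false by rewrite ltnNge ge.
  by rewrite /t sK lt nlt ?(negbTE si) add0r conjc1 mul1r.
(* The conjugate of [e1], in the form met when [wform r rho_perm] is substituted into [theta]: it
   turns the second summand of [theta] into a constant. *)
have e2 i : fpscomp (fpsconj (r (rho_perm i))) (zeta_map r rho_perm) * r i = 1.
  have := congr1 (@fpsconj R p) (e1 (rho_perm i)).
  rewrite rmorphM rmorph1 /= fpsconjK sK fpsconj_comp // /A mconj_zeta_map.
  by rewrite (_ : (fun j => fpsconj (fpsconj (r j))) = r) //; apply: funext => j; rewrite fpsconjK.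
rewrite mconj_wform (wform_comp theta id r ws) (wform_comp _ rho_perm _ (@swap_compat_id p)).
congr wform; apply: funext => i /=.
rewrite fpscomp1 // mul1r /theta fpscompD // fpscompM // !fpscompC // rmorphD rmorphM /=.
rewrite !fpsconjC fpsconjK sK conjcK mulrDl -mulrA e2 mulr1 addrC //.
Qed.


Lemma normal_form (sigma tau1 tau2 rho : fmap) :
  reversible (Anti rho) (Hol sigma) (Hol tau1) (Hol tau2) -> linear_part sigma nu ->
  exists Psi Psi' M L1 L2, normalizes es hs ss (Anti rho) (Hol sigma) (Hol tau1) (Hol tau2)
    Psi Psi' M L1 L2 /\ forall j, M j 0%MM = mu j.
Proof.
move=> H0 ls.
have ws := @swap_compat_rho_perm es hs ss p.
have [Psi [Psi' [s1 [PV lP ls1 es1 eP1]]]] := poincare_dulac ls.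
have [P0 P'0 _ _] := PV.
have s10 := linear_part0 ls1.
have cs : conjugate Psi Psi' (Hol sigma) = Hol s1.
  apply/(conjugateP PV (rev_s0 H0) (s10 : sfix (Hol s1))).
  by rewrite !hol_comp eP1.
have H1 := reversible_conjugate PV H0; rewrite cs in H1.
move: (H1); rewrite !conjugate_Hol conjugate_Anti.
set t11 := fmcomp Psi' (fmcomp tau1 Psi); set t21 := fmcomp Psi' (fmcomp tau2 Psi).
set r1 := fmcomp Psi' (fmcomp rho _) => H1'.
have [e11 e21 er1] := normalized_relations H1' ls1 es1.
have [r r1E] := equivariant_wform (pair_nonresonant_conj nuN) (spectrum_rho_perm eP hlam) er1.
have [s sE] := equivariant_wform (w := id) nuN (fun=> erefl) es1.
have [|theta th0 thr] := @rectify_rho r.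
  by apply: Hol_inj; have := rev_rr H1'; rewrite anti_comp r1E.
have [T' TV lT'] := exists_inverse th0 (linear_part_wform theta).
set T := wform theta id in TV thr.
have VT := formal_inverse_sym TV.
have [T0 T'0 _ _] := TV.
have H2 := reversible_conjugate VT H1'.
have cr : conjugate T' T (Anti r1) = Anti (wform (fun=> 1) rho_perm).
  apply: (conjugate_inv TV); first exact: fixes0_wform.
  apply/(conjugateP TV (fixes0_wform _ _ : sfix (Anti _)) (rev_r0 H1')).
  by rewrite anti_hol_comp hol_anti_comp r1E thr.
(* [T] has index map [id], so it commutes with the linear part; conjugation by it keeps the weights
   of sigma and of the [tau_i], and thereby their shape. *)
have nuV i : nu (swap i) = (nu i)^-1 by exact: spectrum_swap.
have eT : equivariant nu nu T by apply: wform_equivariant.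
have eT' := equivariant_inv TV eT.
have eTV := equivariantV eT.
have [t110 t210] := (rev_t10 H1', rev_t20 H1').
have swf F : fixes0 F -> equivariant (fun i => (nu i)^-1) nu F ->
    exists l, fmcomp T (fmcomp F T') = wform l (@swap p).
  move=> F0 eF; apply: (equivariant_wform nuN (c1 := fun i => (nu i)^-1)) => //.
  by apply: (equivariant_comp T0 (fixes0_comp _ F0) eTV); apply: (equivariant_comp F0 T'0 eF).
have [l1 l1E] := swf _ t110 e11.
have [l2 l2E] := swf _ t210 e21.
have [m mE] : exists m, fmcomp T (fmcomp s1 T') = wform m id.
  apply: (equivariant_wform (w := id) nuN (fun=> erefl)).
  by apply: (equivariant_comp T0 (fixes0_comp _ s10) eT); apply: (equivariant_comp s10 T'0 es1).
(* Constant coefficients in [T s1 = (wform m id) T]: since [theta_i(0)] is nonzero, conjugation by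
   [T] leaves the eigenvalues in place. *)
have m0 i : m i 0%MM = nu i.
  have e : fmcomp T s1 = fmcomp (wform m id) T.
    have [_ _ TT' T'T] := (iffLR (formal_inverseE _ _) TV).
    rewrite -mE fmcompA //; last exact: fixes0_comp.
    by rewrite fmcompA // T'T fmcompf1.
  have s1i : s i 0%MM = nu i.
    have /order_ge2P[_ /(_ i)] := ls1 i; rewrite sE fpscoefB wform1 eqxx mulr1n.
    by rewrite fpscoefCM fpscoefX1 eqxx mulr1 => /eqP; rewrite subr_eq0 => /eqP.
  move: e; rewrite sE !(wform_comp _ _ _ (@swap_compat_id p)) => /wform_inj.
  move=> /(congr1 (fun c : I -> fps R p => c i 0%MM)) /=.
  rewrite !fpscoefM0 !fpscomp_at0 s1i [m i _ * _]mulrC => /(mulfI (th0 i)) <- //.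
rewrite !conjugate_Hol cr l1E l2E mE in H2.
have [l1V l2V mE' _] := standard_relations H2.
have mV i : m i * m (swap i) = 1.
  by rewrite !mE' swapK mulrACA l1V [l2 (swap i) * _]mulrC l2V mulr1.
exists (fmcomp Psi T'), (fmcomp T Psi'), (fun j => m (lshift p j)), (fun j => l1 (lshift p j)),
  (fun j => l2 (lshift p j)).
have cc f : sfix f -> conjugate (fmcomp Psi T') (fmcomp T Psi') f = conjugate T' T (conjugate Psi Psi' f).
  by move=> f0; rewrite (conjugate_conjugate PV VT f0).
split; last by move=> j; rewrite m0 /nu spectrum_l.
split.
- exact: formal_inverse_comp.
- by move=> j; split; [exact: (unit_at0 (mV _)) | exact: (unit_at0 (l1V _)) | exact: (unit_at0 (l2V _))].
- by rewrite (cc _ (rev_r0 H0)) conjugate_Anti -/r1 cr std_rhoE.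
- by rewrite (cc _ (rev_s0 H0)) cs conjugate_Hol mE sigma_formE -(inv_pairP mV).
split.
  by rewrite (cc _ (rev_t10 H0)) !conjugate_Hol -/t11 l1E tau_formE -(inv_pairP l1V).
by rewrite (cc _ (rev_t20 H0)) !conjugate_Hol -/t21 l2E tau_formE -(inv_pairP l2V).
Qed.

End PartOne.

(** * Normalization of the diagonal terms *)

Section DiagonalNormalization.
Variable R : realType.
Local Notation C := R[i].
Variables (p : nat) (f : formal_map R p p).
Hypothesis f2 : forall j, order_ge 2 (f j).

Let perturb (al : formal_map R p p) : formal_map R p p := fun j => psX R j + al j.

(* A = id + al has components divisible by zeta_j, and (id + f) o A - id is diagonal free. *)
Definition diagonal_solution (al : formal_map R p p) :=
  [/\ forall j, order_ge 2 (al j),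
      forall j (m : 'X_{1..p}), m j = 0%N -> al j m = 0
    & forall j (m : 'X_{1..p}), m j != 0%N -> (al j + fpscomp (f j) (perturb al)) m = 0].

(** The two conditions on [al j] concern complementary sets of exponents, those with [m j = 0] and
    the others, and together prescribe every coefficient. *)
Let Phi (al : formal_map R p p) : formal_map R p p :=
  fun j m => if m j == 0%N then 0 else - fpscomp (f j) (perturb al) m.

Let perturb0 al : (forall j, order_ge 2 (al j)) -> fixes0 (perturb al).
Proof. by move=> a2 j; apply/order_ge1P/order_geD; [apply: order_geX | apply: (order_ge_le _ (a2 j))]. Qed.

Let Phia u : (forall j, order_ge 2 (u j)) -> forall j, order_ge 2 (Phi u j).
Proof.
move=> u2 j m lm; rewrite /Phi (order_ge_comp (perturb0 u2) (f2 j) lm) oppr0.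
by case: ifP.
Qed.

Let PhiC d u v : (forall j, order_ge 2 (u j)) -> (forall j, order_ge 2 (v j)) ->
  (forall j, order_ge d (u j - v j)) -> forall j, order_ge d.+1 (Phi u j - Phi v j).
Proof.
move=> u2 v2 uv j; apply/order_ge_subP => m lm; rewrite /Phi; case: ifP => // _; congr (- _).
have /order_ge_subP h : order_ge d.+1 (fpscomp (f j) (perturb u) - fpscomp (f j) (perturb v)).
  rewrite -[d.+1]add1n; apply: (order_ge_comp_sub (a := 1)) => //; try exact: perturb0.
  by move=> k; rewrite /perturb opprD addrACA subrr add0r.
exact: h.
Qed.

Let diagonal_solutionP al : diagonal_solution al <-> (forall j, order_ge 2 (al j)) /\ Phi al = al.
Proof.
split=> [[a2 a0 a1]|[a2 e]].
  split=> //; apply: funext => j; apply: fpsP => m; rewrite /Phi.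
  have [m0|m0] := eqVneq (m j) 0%N; first by rewrite a0.
  by have /eqP := a1 j m m0; rewrite fpscoefD addr_eq0 => /eqP->.
by split=> // j m mj; rewrite ?fpscoefD -[in al j]e /Phi ?mj ?(negbTE mj) ?addNr.
Qed.

Lemma diagonal_solution_exists : exists al, diagonal_solution al.
Proof.
by have [al a2 e] := contraction_exists Phia PhiC; exists al; apply/diagonal_solutionP.
Qed.

Lemma diagonal_solution_unique al al' :
  diagonal_solution al -> diagonal_solution al' -> al = al'.
Proof.
move=> /diagonal_solutionP[a2 e] /diagonal_solutionP[a2' e'].
exact: (contraction_unique PhiC).
Qed.

End DiagonalNormalization.

Section LogM.
Variable R : realType.
Local Notation C := R[i].
Variables es p : nat.

Definition log_factor (j : 'I_p) : C := if (j < es)%N then 1 else - 'i%C.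

Lemma logM_fpslog (M : formal_map R p p) j : logM es M j = fpsC (log_factor j) * fpslog (M j).
Proof.
rewrite /logM /log_factor; case: ifP => _; rewrite ?psscaleE pslog_fpslog //.
by rewrite rmorph1 mul1r.
Qed.

Lemma logM_comp (M A : formal_map R p p) : fixes0 A -> (forall j, M j 0%MM != 0) ->
  logM es (fmcomp M A) = fmcomp (logM es M) A.
Proof.
move=> A0 M0; apply: funext => j; rewrite /fmcomp logM_fpslog fpslog_comp // logM_fpslog fpscompM //.
by rewrite fpscompC.
Qed.

Lemma tangent_to_idP (F : formal_map R p p) :
  tangent_to_id F <-> forall j, order_ge 2 (F j - psX R j).
Proof. by split=> h j; [apply/order_ge_subP => m | have /order_ge_subP := h j => hj m] => lm; apply: h || apply: hj. Qed.

End LogM.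

(** * The action of rho on series in zeta *)

Section Star.
Variable R : realType.
Local Notation C := R[i].
Variables es hs ss p : nat.
Local Notation I := 'I_(p + p).
Hypothesis eP : (es + hs + 2 * ss)%N = p.
Local Notation rho_perm := (@rho_perm es hs ss p).
Local Notation partner := (@partner es hs ss p).
Local Notation rho_conj := (@rho_conj R es hs ss p).

Lemma fpscoef_perm (s : 'I_p -> 'I_p) (g : fps R p) m : involutive s ->
  fpscomp g (fun j => psX R (s j)) m = g [multinom m (s j) | j < p].
Proof.
move=> sK; have sm : forall k : 'X_{1..p}, [multinom [multinom k (s j) | j < p] (s j) | j < p] = k.
  by move=> k; apply/mnmP => j; rewrite !mnmE sK.
have ms (k : 'X_{1..p}) : mmap1 (fun j => psX R (s j)) k = fps_of_mpoly 'X_[[multinom k (s j) | j < p]].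
  rewrite mpolyXE_id rmorph_prod /mmap1 (reindex_inj (inv_inj sK)) /=; apply: eq_bigr => j _.
  by rewrite rmorphXn /= fps_of_mpolyX mnmE sK.
rewrite fpscompE fpsevalE fpscoef_sum.
under eq_bigr => k _ do rewrite fpscoefCM ms [fps_of_mpoly _ _]mcoeffX.
set m' := [multinom m (s j) | j < p].
have dm : (mdeg m' <= mdeg m)%N.
  rewrite !mdegE (reindex_inj (inv_inj sK)) /= leq_eqVlt; apply/orP; left; apply/eqP.
  by apply: eq_bigr => j _; rewrite mnmE sK.
rewrite -(pstruncE g dm); set q := pstrunc _ g.
rewrite [in RHS](mpolyE q) raddf_sum /=; apply: eq_bigr => k _; rewrite mcoeffZ mcoeffX.
congr (_ * _%:R); congr nat_of_bool; apply/eqP/eqP => [e|->]; last by rewrite /m' sm.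
by rewrite /m' -e sm.
Qed.

Lemma zeta_map_rhoE : zeta_map (fun=> 1) rho_perm = (fun j => psX R (partner j)) :> formal_map R p p.
Proof. by apply: funext => j; rewrite /zeta_map !mul1r base_map_rho_perm. Qed.

Let P0 : fixes0 (zeta_map (fun=> (1 : fps R p)) rho_perm). Proof. exact: fixes0_zeta_map. Qed.

Lemma rho_conjE (f : fps R p) m : rho_conj f m = conjc (f [multinom m (partner j) | j < p]).
Proof. by rewrite /rho_conj zeta_map_rhoE fpscoef_perm //; apply: partnerK. Qed.

Lemma rho_conj_is_zmod_morphism : zmod_morphism rho_conj.
Proof. by move=> f g; rewrite /rho_conj rmorphB fpscompB. Qed.
Lemma rho_conj_is_monoid_morphism : monoid_morphism rho_conj.
Proof. by split=> [|f g]; rewrite /rho_conj ?rmorph1 ?fpscomp1 // rmorphM fpscompM. Qed.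
HB.instance Definition _ := GRing.isZmodMorphism.Build _ _ rho_conj rho_conj_is_zmod_morphism.
HB.instance Definition _ := GRing.isMonoidMorphism.Build _ _ rho_conj rho_conj_is_monoid_morphism.

Lemma rho_conj0 (f : fps R p) : rho_conj f 0%MM = conjc (f 0%MM).
Proof. by rewrite /rho_conj fpscomp_at0. Qed.

Lemma rho_conjC c : rho_conj (fpsC c) = fpsC (conjc c).
Proof. by rewrite /rho_conj fpsconjC fpscompC. Qed.

Lemma rho_conjX j : rho_conj (psX R j) = psX R (partner j).
Proof. by rewrite /rho_conj fpsconjX fpscompX // zeta_map_rhoE. Qed.

Lemma rho_conjK : involutive rho_conj.
Proof.
move=> f; apply: fpsP => m; rewrite !rho_conjE conjcK; congr (f _).
by apply/mnmP => j; rewrite !mnmE partnerK.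
Qed.

Lemma order_ge_rho_conj d f : order_ge d f -> order_ge d (rho_conj f).
Proof. by move=> fd; apply: order_ge_comp => //; apply: order_ge_conj. Qed.

(** The inner family on the right is [A] conjugated by the anti-holomorphic involution that [rho]
    induces on [zeta]. *)
Lemma rho_conj_comp (f : fps R p) (A : formal_map R p p) : fixes0 A ->
  rho_conj (fpscomp f A) = fpscomp (rho_conj f) (fun j => rho_conj (A (partner j))).
Proof.
move=> A0; have A0' : fixes0 (fun j => rho_conj (A (partner j))).
  by move=> j; rewrite rho_conj0 A0 conjc0.
have cA0 := fixes0_conj A0.
rewrite /rho_conj fpsconj_comp // !fpscompA //; congr fpscomp; apply: funext => j.
by rewrite /fmcomp [X in _ = fpscomp X _]/zeta_map !mul1r base_map_rho_perm // fpscompX //= partnerK.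
Qed.

Lemma rho_conj_log (f : fps R p) : f 0%MM != 0 -> rho_conj (fpslog f) = fpslog (rho_conj f).
Proof.
by move=> f0; rewrite /rho_conj fpslog_conj // fpslog_comp // /fpsconj conjc_eq0.
Qed.

Lemma mconj_zeta_map_rho : mconj (zeta_map (fun=> 1) rho_perm) = zeta_map (fun=> 1) rho_perm :> formal_map R p p.
Proof. by rewrite mconj_zeta_map; congr zeta_map; apply: funext => i; rewrite rmorph1. Qed.

Lemma rho_conj_flip (f g : fps R p) : rho_conj f = g -> fpsconj g = fpscomp f (zeta_map (fun=> 1) rho_perm).
Proof. by move=> <-; rewrite /rho_conj fpsconj_comp // fpsconjK mconj_zeta_map_rho. Qed.

End Star.

(** * Existence of the normalized form *)

Section PartTwo.
Variable R : realType.
Local Notation C := R[i].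
Variables es hs ss p : nat.
Local Notation I := 'I_(p + p).
Local Notation fmap := (formal_map R (p + p) (p + p)).
Hypothesis eP : (es + hs + 2 * ss)%N = p.
Local Notation rho_perm := (@rho_perm es hs ss p).
Local Notation partner := (@partner es hs ss p).
Local Notation rho_conj := (@rho_conj R es hs ss p).
Local Notation log_factor := (@log_factor R es p).

Lemma divisible_by_X (f : fps R p) j : (forall m : 'X_{1..p}, m j = 0%N -> f m = 0) ->
  exists g, f = g * psX R j.
Proof.
move=> f0; exists (fun m => f (m + U_(j))%MM); apply: fpsP => m; rewrite fpscoefMX.
case: eqP => [/f0 //|/eqP mj]; by rewrite submK // lep1mP.
Qed.

Section Existence.
Variables M L1 L2 : formal_map R p p.
Hypothesis M0 : forall j, M j 0%MM != 0.
Hypothesis L10 : forall j, L1 j 0%MM != 0.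
Let m := inv_pair M.
Let l1 := inv_pair L1.
Let l2 := inv_pair L2.
Hypothesis rel : reversible (Anti (wform (fun=> 1) rho_perm)) (Hol (wform m id))
    (Hol (wform l1 (@swap p))) (Hol (wform l2 (@swap p))).
Hypothesis Mid : tangent_to_id (logM es M).

Let ws := @swap_compat_rho_perm es hs ss p.
Let sK := @rho_permK es hs ss p eP.

Let l1V i : l1 i * l1 (swap i) = 1. Proof. by case: (standard_relations eP rel). Qed.
Let l2V i : l2 i * l2 (swap i) = 1. Proof. by case: (standard_relations eP rel). Qed.
Let mE i : m i = l1 i * l2 (swap i). Proof. by case: (standard_relations eP rel). Qed.
Let l2E i : l2 i = rho_conj (l1 (rho_perm i)). Proof. by case: (standard_relations eP rel). Qed.
Let mV i : m i * m (swap i) = 1. Proof. exact: inv_pair_swap. Qed.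

(** The relation [rho sigma rho = sigma^-1] on coefficients. *)
Let star_m i : rho_conj (m i) = m (rho_perm (swap i)).
Proof.
rewrite !mE rmorphM /= ![in LHS]l2E rho_conjK // -ws swapK [in RHS]mulrC; congr (_ * _).
by rewrite l2E sK.
Qed.

(** This is the purpose of the factor [-i] in [logM]. For elliptic [j], [rho] preserves [M_j].
    Otherwise it takes [M] at the partner to the inverse of [M_j], which changes the sign of the
    logarithm, and conjugating [-i] changes it back. So [log M] commutes with the involution on
    [zeta]. *)
Let star_logM j : rho_conj (logM es M (partner j)) = logM es M j.
Proof.
rewrite !logM_fpslog rmorphM /= rho_conjC // rho_conj_log // /log_factor partner_es //.
have -> : M (partner j) = m (lshift p (partner j)) by rewrite /m inv_pair_l.
rewrite star_m swap_l rho_perm_r partner_es //; case: ifP => je.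
  by rewrite conjc1 partner_id // /m inv_pair_l.
rewrite partnerK // /m inv_pair_r fpslogV //.
have -> : conjc (- 'i%C) = 'i%C :> C by apply/eqP; rewrite eq_complex /= oppr0 opprK !eqxx.
by rewrite mulrN -mulNr -rmorphN.
Qed.

(** With [Phi = wform a id] there are three demands: [a_i a_(swap i) = A_j / zeta_j] for
    [j = base i], so that [Phi] induces [A]; [rho_conj (a i) = a (rho_perm i)], so that [Phi]
    commutes with [rho]; and the product of the new Lambda equal to 1. *)
Lemma normalization_exists : exists hM Phi Phi' hL1 hL2,
  [/\ normalizes es hs ss (Anti (wform (fun=> 1) rho_perm)) (Hol (wform m id))
        (Hol (wform l1 (@swap p))) (Hol (wform l2 (@swap p))) Phi Phi' hM hL1 hL2,
      forall j, hM j 0%MM = M j 0%MM,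
      forall j, hL2 j = psinv (hL1 j),
      tangent_to_id (logM es hM)
    & diagonal_free (logM es hM)].
Proof.
pose F := logM es M; pose f j := F j - psX R j.
have f2 j : order_ge 2 (f j) by move/tangent_to_idP: Mid => /(_ j).
have [al sal] := diagonal_solution_exists f2.
pose A j := psX R j + al j.
have [al2 alX alF] := sal.
have A0 : fixes0 A.
  by move=> j; apply/order_ge1P/order_geD; [apply: order_geX | apply: (order_ge_le _ (al2 j))].
have star_f j : rho_conj (f (partner j)) = f j.
  by rewrite /f rmorphB /= rho_conjX // partnerK // star_logM.
have star_al : (fun j => rho_conj (al (partner j))) = al.
  apply: (diagonal_solution_unique f2 _ sal); split=> [j|j k kj|j k kj].
  - by apply: order_ge_rho_conj.
  - by rewrite rho_conjE // alX ?conjc0 // mnmE partnerK.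
  have e : (fun j => psX R j + rho_conj (al (partner j))) = (fun j => rho_conj (A (partner j))).
    by apply: funext => i; rewrite /A rmorphD /= rho_conjX // partnerK.
  rewrite e -star_f -rho_conj_comp // -rmorphD /= rho_conjE //.
  by rewrite [X in conjc X]alF ?conjc0 // mnmE partnerK.
have star_A j : rho_conj (A (partner j)) = A j.
  rewrite /A rmorphD /= rho_conjX // partnerK //.
  by rewrite [rho_conj (al _)](congr1 (fun a : formal_map R p p => a j) star_al).
have /choice[c cE] : forall j, exists g, A j = g * psX R j.
  move=> j; apply: divisible_by_X => k kj; rewrite /A fpscoefD alX // fpscoefX addr0.
  by case: eqP kj => // ->; rewrite mnm1E eqxx.
have c1 j : c j 0%MM = 1.
  have : A j U_(j)%MM = 1.
    by rewrite /A fpscoefD fpscoefX1 eqxx (al2 j) ?addr0 // mdeg1.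
  by rewrite cE fpscoefMX mnm1E eqxx /= -{1}[U_(_)%MM]add0m addmK.
have star_c j : rho_conj (c (partner j)) = c j.
  apply: (@mulX_inj _ _ _ _ j); rewrite -cE -star_A cE rmorphM /= rho_conjX //.
  by rewrite partnerK.
(* A square root with constant term 1 is unique, so [e] inherits the invariance of [c] under
   [rho]. *)
have /choice[e eE] : forall j, exists g : fps R p, g 0%MM = 1 /\ g ^+ 2 = c j.
  by move=> j; have [g g1 g2] := fps_sqrt1 (c1 j); exists g.
have star_e j : rho_conj (e (partner j)) = e j.
  apply: fps_sqrt1_unique; first by rewrite rho_conj0 // (eE _).1 conjc1.
    exact: (eE j).1.
  by rewrite -rmorphXn /= !(eE _).2 star_c.
have L1A j : fpscomp (L1 j) A 0%MM != 0 by rewrite fpscomp_at0.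
(* For [a_i = e u_i] with [u_i u_(swap i) = 1], the quotient [a_(swap i) / a_i] is [u_i^-2] and
   enters both new Lambda, so [u_i^4] must equal [(l1_i l2_i) o A]. The factor of [u] coming from
   [l1] is [g]. *)
have /choice[ga gaE] : forall j, exists g : fps R p, g ^+ 4 = fpscomp (L1 j) A.
  by move=> j; apply: fps_root4.
have ga0 j : ga j 0%MM != 0.
  by have := L1A j; rewrite -gaE fpscoefX0n expf_eq0.
pose g := inv_pair ga; have gV i : g i * g (swap i) = 1 by exact: inv_pair_swap.
have g4 i : g i ^+ 4 = fpscomp (l1 i) A.
  move: i; apply: xi_eta_ind => j; rewrite /g /l1 ?inv_pair_l ?inv_pair_r //.
  rewrite fpsinv_comp // -gaE; apply: fpsinv_unique.
  by rewrite -exprMn fpsinvP // expr1n.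
(* Taking for [s] the image of [g] under [rho] makes [rho] exchange the two factors of [a]. That
   [s^4 = l2 o A] comes from [tau_2 = rho tau_1 rho] and the invariance of [A]. *)
pose s i := rho_conj (g (rho_perm i)).
have sV i : s i * s (swap i) = 1 by rewrite /s -rmorphM /= ws gV rmorph1.
have s4 i : s i ^+ 4 = fpscomp (l2 i) A.
  rewrite /s -rmorphXn /= g4 rho_conj_comp // -l2E; congr fpscomp.
  by apply: funext => j; rewrite star_A.
pose a i := e (base i) * (g i * s i).
have aV i : a i * a (swap i) = c (base i).
  rewrite /a base_swap mulrACA -expr2 (eE _).2.
  by rewrite mulrACA gV sV !mulr1.
have a0 i : a i 0%MM != 0.
  have : (a i * a (swap i)) 0%MM = 1 by rewrite aV c1.
  by rewrite fpscoefM0; case: eqP => // -> /eqP; rewrite mul0r eq_sym oner_eq0.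
have star_a i : rho_conj (a i) = a (rho_perm i).
  rewrite /a /s !rmorphM /= rho_conjK // sK base_map_base // base_map_rho_perm // -{1}[base i](partnerK eP).
  by rewrite star_e [rho_conj (g i) * _]mulrC.
have amapA : zeta_map a id = A.
  by apply: funext => j; rewrite /zeta_map -swap_l aV /base_map base_l cE.
pose Phi := wform a id.
have [Phi' PV _] := exists_inverse a0 (linear_part_wform a).
pose ia i := fpsinv (a i); have iaP i : a i * ia i = 1 by exact: fpsinvP.
pose hm i := fpscomp (m i) A.
have hmV i : hm i * hm (swap i) = 1 by rewrite /hm -fpscompM // mV fpscomp1.
pose hl l i := fpscomp (l i) A * (a (swap i) * ia i) : fps R p.
have hlV l i : l i * l (swap i) = 1 -> hl l i * hl l (swap i) = 1.
  move=> lV; rewrite /hl swapK mulrACA -fpscompM // lV fpscomp1 // mul1r mulrACA.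
  by rewrite [a (swap i) * a i]mulrC mulrACA !iaP mulr1.
have hh i : hl l1 i * hl l2 i = 1.
  rewrite /hl -g4 -s4; apply: (@fps_regular _ _ (a i ^+ 2)).
    by rewrite fpscoefX0n expf_neq0.
  have -> : a i ^+ 2 * (g i ^+ 4 * (a (swap i) * ia i) * (s i ^+ 4 * (a (swap i) * ia i))) =
    (g i * s i) ^+ 4 * a (swap i) ^+ 2 * (a i * ia i) ^+ 2 by ring.
  rewrite iaP expr1n !mulr1 /a base_swap.
  have -> : (g i * s i) ^+ 4 * (e (base i) * (g (swap i) * s (swap i))) ^+ 2 =
    (e (base i) * (g i * s i)) ^+ 2 * ((g i * g (swap i)) * (s i * s (swap i))) ^+ 2 by ring.
  by rewrite gV sV mulr1 expr1n mulr1.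
(* As [wform y w] induces the identity on [zeta], conjugacy reduces to the last hypothesis, with no
   substitution on the right. It is solved by [hm] for [w = id] and by [hl] for [w = swap]. *)
have conjF (w : I -> I) (x y : I -> fps R p) : swap_compat w -> zeta_map y w = @idmap R p ->
    (forall i, fpscomp (x i) A * a (w i) = a i * y i) ->
    conjugate Phi Phi' (Hol (wform x w)) = Hol (wform y w).
  move=> ww yw xy.
  apply/(conjugateP PV (fixes0_wform _ _ : sfix (Hol _)) (fixes0_wform _ _ : sfix (Hol _))).
  rewrite !hol_comp (wform_comp _ _ _ (@swap_compat_id p)) (wform_comp _ _ _ ww) amapA yw.
  by congr (Hol (wform _ _)); apply: funext => i; rewrite fpscomp_id xy.
have conj_l l : (forall i, l i * l (swap i) = 1) ->
    conjugate Phi Phi' (Hol (wform l (@swap p))) = Hol (wform (hl l) (@swap p)).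
  move=> lV; have lV' i := hlV l i (lV i).
  apply: conjF; [by []|exact: (zeta_map_unit lV' (@base_map_swap p))|move=> i].
  rewrite /hl; set B := fpscomp _ _.
  have -> : a i * (B * (a (swap i) * ia i)) = B * a (swap i) * (a i * ia i) by ring.
  by rewrite iaP mulr1.
exists (fun j => hm (lshift p j)), Phi, Phi', (fun j => hl l1 (lshift p j)), (fun j => hl l2 (lshift p j)).
have hlV1 i := hlV l1 i (l1V i); have hlV2 i := hlV l2 i (l2V i).
have hME : (fun j => hm (lshift p j)) = fmcomp M A.
  by apply: funext => j; rewrite /hm /m inv_pair_l.
have hF : logM es (fun j => hm (lshift p j)) = fmcomp F A by rewrite hME logM_comp.
have FA j : fmcomp F A j = psX R j + (al j + fpscomp (f j) A).
  rewrite /fmcomp; have -> : F j = psX R j + f j by rewrite addrC subrK.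
  by rewrite fpscompD // fpscompX // addrA.
split.
- split.
  + exact: PV.
  + move=> j; split; [exact: (unit_at0 (hmV _))|exact: (unit_at0 (hlV1 _))|exact: (unit_at0 (hlV2 _))].
  + rewrite std_rhoE.
    apply/(conjugateP PV (fixes0_wform _ _ : sfix (Anti _)) (fixes0_wform _ _ : sfix (Anti _))).
    rewrite anti_hol_comp hol_anti_comp mconj_wform.
    rewrite (wform_comp _ _ _ (@swap_compat_id p)) (wform_comp _ _ _ ws).
    congr (Anti (wform _ _)); apply: funext => i; rewrite fpscomp1 // mul1r mulr1.
    exact: (rho_conj_flip (star_a i)).
  + rewrite sigma_formE -(inv_pairP hmV); apply: conjF; [by []|exact: (zeta_map_unit hmV (@base_map_id p))|].
    by move=> i; rewrite mulrC.
  split; rewrite tau_formE.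
    by rewrite -(inv_pairP hlV1); apply: conj_l.
  by rewrite -(inv_pairP hlV2); apply: conj_l.
- by move=> j; rewrite /hm fpscomp_at0 /m inv_pair_l.
- by move=> j; rewrite psinv_fpsinv; apply: fpsinv_unique.
- rewrite hF; apply/tangent_to_idP => j; rewrite FA addrC addKr.
  by apply: order_geD => //; apply: order_ge_comp.
by move=> j k kj; rewrite hF FA fpscoefD addrC addKr alF.
Qed.

End Existence.
End PartTwo.

(** * Uniqueness *)

Section Uniqueness.
Variable R : realType.
Local Notation C := R[i].
Variables es p : nat.
Local Notation I := 'I_(p + p).
Local Notation fmap := (formal_map R (p + p) (p + p)).

(** Injectivity of [nu], itself a consequence of nonresonance, forces [s] to commute with [swap], so
    the pairs are respected. *)
Lemma pair_nonresonant_perm (nu n : I -> C) (s : I -> I) : injective s ->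
  (forall i, n (s i) = nu i) -> (forall i, nu (swap i) = (nu i)^-1) ->
  (forall i, n (swap i) = (n i)^-1) -> pair_nonresonant nu -> pair_nonresonant n.
Proof.
move=> sI ns nuV nV nr m m'.
have cE k : cpow n k = cpow nu [multinom k (s i) | i < p + p].
  by rewrite /cpow (reindex_inj sI); apply: eq_bigr => i _; rewrite mnmE ns.
have ssw i : s (swap i) = swap (s i).
  apply: (canLR (f_invF sI)); apply: (pair_nonresonant_inj nr).
  by rewrite nuV -!ns f_invF nV.
rewrite !cE => /nr h i; have := h (invF sI i); rewrite !mnmE ssw f_invF //.
Qed.

(** Some term of the Leibniz formula for the determinant of the Jacobian of [P] is nonzero. In
    [diag(nu) J = J diag(n)], its nonzero entries [(i, s i)] give [nu i = n (s i)]. *)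
Lemma conjugate_spectrum (nu n : I -> C) (F G P P' : fmap) :
  formal_inverse P P' -> linear_part F nu -> linear_part G n -> fmcomp F P = fmcomp P G ->
  exists2 s : I -> I, injective s & forall i, n (s i) = nu i.
Proof.
move=> /formal_inverseE[P0 P'0 PP' P'P] lF lG e.
have F0 := linear_part0 lF; have G0 := linear_part0 lG.
have JP : jacobian P *m jacobian P' = 1%:M by rewrite -jacobianM // PP' jacobian_id.
have : \det (jacobian P) != 0.
  apply/eqP => d0; have /eqP := congr1 (fun A : 'M_(p + p) => \det A) JP.
  by rewrite det_mulmx d0 mul0r det1 eq_sym oner_eq0.
rewrite /determinant => /eqP dP; have [s sP] : exists s : {perm I}, \prod_i jacobian P i (s i) != 0.
  apply/existsP; rewrite -negb_forall; apply/negP => /forallP h; apply: dP.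
  rewrite big1 // => s _; have /eqP -> := h s; exact: mulr0.
exists s => [|i]; first exact: perm_inj.
have := congr1 (fun K : fmap => jacobian K i (s i)) e => /=.
rewrite !jacobianM // (linear_partP nu F0).1 // (linear_partP n G0).1 //.
rewrite mul_diag_mx mul_mx_diag !mxE mulrC => /mulfI -> //.
by have := sP; rewrite prodf_seq_neq0 => /allP/(_ i (mem_index_enum _)); rewrite mxE.
Qed.

(** [F] is [wform c id] and induces a map [A] with [hM' = hM o A]; both [A - id] and [0] solve the
    diagonal problem of [log hM]. The conclusion [A = id] constrains only the products
    [c_i c_(swap i)], hence [hM] but not [F]. *)
Lemma normalization_unique (hM hM' : formal_map R p p) (F F' : fmap) :
  (forall j, hM j 0%MM != 0) -> (forall j, hM' j 0%MM = hM j 0%MM) ->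
  pair_nonresonant (spectrum (fun j => hM j 0%MM)) ->
  formal_inverse F F' -> fmcomp (wform (inv_pair hM) id) F = fmcomp F (wform (inv_pair hM') id) ->
  tangent_to_id (logM es hM) -> tangent_to_id (logM es hM') ->
  diagonal_free (logM es hM) -> diagonal_free (logM es hM') -> hM = hM'.
Proof.
move=> hM0 hMM nr FV eF /tangent_to_idP tM /tangent_to_idP tM' dM dM'.
have hM'0 j : hM' j 0%MM != 0 by rewrite hMM.
pose n := spectrum (fun j => hM j 0%MM).
have n0 i : n i != 0 by exact: spectrum_neq0.
have nV i : n (swap i) = (n i)^-1 by exact: spectrum_swap.
have [F0 F'0 _ _] := FV.
have lw (K : formal_map R p p) : (forall j, K j 0%MM = hM j 0%MM) -> linear_part (wform (inv_pair K) id) n.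
  move=> KM; have -> : n = (fun i => inv_pair K i 0%MM); last exact: linear_part_wform.
  apply: funext; apply: xi_eta_ind => j; rewrite /n ?spectrum_l ?spectrum_r ?inv_pair_l ?inv_pair_r //.
  by rewrite fpsinv0 KM.
have ew K : equivariant n n (wform (inv_pair K) id) by apply: wform_equivariant.
have eqF : equivariant n n F.
  by apply: (intertwine_linear F0 (lw hM _) (lw hM' _) (ew _) (ew _)).
have eqF' := equivariant_inv FV eqF.
have [c cE] := equivariant_wform (w := id) nr (fun=> erefl) eqF.
have [d dE] := equivariant_wform (w := id) nr (fun=> erefl) eqF'.
have c0 i : c i 0%MM != 0.
  have [_ _ e _] := (iffLR (formal_inverseE _ _) FV).
  move: e; rewrite cE dE (wform_comp _ _ _ (@swap_compat_id p)) -wform_id => /wform_inj.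
  move=> /(congr1 (fun c : I -> fps R p => c i 0%MM)) /=.
  rewrite fpscoefM0 fpscomp_at0 fpscoef1 eqxx; case: eqP => // -> /eqP.
  by rewrite mul0r eq_sym oner_eq0.
pose A := zeta_map c id; have A0 : fixes0 A by exact: fixes0_zeta_map.
have hMA : hM' = fmcomp hM A.
  have V' i : inv_pair hM' i * inv_pair hM' (swap i) = 1 by exact: inv_pair_swap.
  move: eF; rewrite cE !(wform_comp _ _ _ (@swap_compat_id p)) (zeta_map_unit V' (@base_map_id p)).
  move=> /wform_inj e; apply: funext => j.
  have := congr1 (fun c : I -> fps R p => c (lshift p j)) e.
  by rewrite /= fpscomp_id !inv_pair_l mulrC => /(fps_regular (c0 _)) <-.
have HA : logM es hM' = fmcomp (logM es hM) A by rewrite hMA logM_comp.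
pose f j := logM es hM j - psX R j.
have f2 j : order_ge 2 (f j) by exact: tM.
have FA j : logM es hM' j = A j + fpscomp (f j) A.
  rewrite HA /fmcomp; have -> : logM es hM j = psX R j + f j by rewrite addrC subrK.
  by rewrite fpscompD // fpscompX.
pose al j := A j - psX R j.
(* The linear part of [A] is not given in advance; it follows from the tangency of both logarithms
   to the identity. *)
have al2 j : order_ge 2 (al j).
  have -> : al j = (logM es hM' j - psX R j) - fpscomp (f j) A by rewrite FA /al; ring.
  by apply: order_geB; [exact: tM' | apply: order_ge_comp].
have Aal : (fun j => psX R j + al j) = A by apply: funext => j; rewrite /al addrC subrK.
have s1 : diagonal_solution f al.
  split=> // j m mj.
    rewrite /al fpscoefB /A /zeta_map fpscoefMX base_map_id mj eqxx sub0r fpscoefX.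
    by case: eqP mj => [->|_]; rewrite ?oppr0 // mnm1E eqxx.
  rewrite Aal; have -> : al j + fpscomp (f j) A = logM es hM' j - psX R j by rewrite FA /al; ring.
  by rewrite fpscoefB dM'.
(* For the zero family the last condition says that [log hM] is already diagonal free. *)
have s0 : diagonal_solution f (fun=> 0).
  split=> [j|j m mj|j m mj]; [exact: order_ge0|exact: fpscoef0|].
  have -> : (fun j => psX R j + 0) = @idmap R p by apply: funext => k; rewrite addr0.
  by rewrite fpscomp_id add0r /f fpscoefB dM.
have al0 := diagonal_solution_unique f2 s1 s0.
have A1 : A = @idmap R p by rewrite -Aal al0; apply: funext => j; rewrite addr0.
by rewrite hMA A1 fmcompf1.
Qed.

End Uniqueness.

Lemma jacobian_hatS (R : realType) (p : nat) (F : formal_map R (p + p) (p + p)) mu :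
  fixes0 F -> jacobian F = hatS mu -> linear_part F (spectrum mu).
Proof.
move=> F0 J; apply/linear_partP => //; rewrite J.
apply/matrixP => i j; rewrite /hatS.
case: (split_ordP i) => i' ->; case: (split_ordP j) => j' ->.
- by rewrite block_mxEul !mxE spectrum_l eq_lshift.
- by rewrite block_mxEur !mxE eq_lrshift mulr0n.
- by rewrite block_mxEdl !mxE eq_rlshift mulr0n.
by rewrite block_mxEdr !mxE spectrum_r eq_rshift.
Qed.

Theorem theorem1p2 (R : realType) (es hs ss p : nat)
    (lam mu : 'I_p -> R[i]) (sigma tau1 tau2 rho : formal_map R (p + p) (p + p)) :
  (es + hs + 2 * ss)%N = p ->
  eigenvalues_normalized es hs ss lam mu ->
  nonresonant mu ->
  holomorphic_germ sigma ->
  jacobian sigma = hatS mu ->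
  holomorphic_germ tau1 -> is_involution (Hol tau1) ->
  holomorphic_germ rho -> is_involution (Anti rho) ->
  Hol tau2 = scomp (Anti rho) (scomp (Hol tau1) (Anti rho)) ->
  Hol sigma = scomp (Hol tau1) (Hol tau2) ->
  (exists Psi Psi' M L1 L2,
     normalizes es hs ss (Anti rho) (Hol sigma) (Hol tau1) (Hol tau2)
       Psi Psi' M L1 L2 /\
     forall j, M j 0%MM = mu j) /\
  (forall Psi Psi' M L1 L2,
     normalizes es hs ss (Anti rho) (Hol sigma) (Hol tau1) (Hol tau2)
       Psi Psi' M L1 L2 ->
     tangent_to_id (logM es M) ->
     exists! hM, exists Phi Phi' hL1 hL2,
       [/\ normalizes es hs ss
             (std_rho R es hs ss p) (sigma_form M) (tau_form L1) (tau_form L2)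
             Phi Phi' hM hL1 hL2,
           forall j, hM j 0%MM = M j 0%MM,
           forall j, hL2 j = psinv (hL1 j),
           tangent_to_id (logM es hM)
         & diagonal_free (logM es hM)]).
Proof.
move=> eP hlam hmu [s0 _] Js [t10 _] t1t1 [r0 _] rr t2E sE.
have ls := jacobian_hatS s0 Js.
have t20 : sfix (Hol tau2) by rewrite t2E; apply: sfix_comp.
have H0 : reversible (Anti rho) (Hol sigma) (Hol tau1) (Hol tau2).
  exact: (Reversible (r0 : sfix (Anti _)) (s0 : sfix (Hol _)) (t10 : sfix (Hol _)) t20 rr t1t1 t2E sE).
split; first exact: (normal_form eP hlam hmu H0 ls).
move=> Psi Psi' M L1 L2 [PV nz cr cs [ct1 ct2]] Mid.
have M0 j : M j 0%MM != 0 by case: (nz j).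
have L10 j : L1 j 0%MM != 0 by case: (nz j).
have := reversible_conjugate PV H0.
rewrite cr cs ct1 ct2 std_rhoE sigma_formE !tau_formE => H1.
have [hM [Phi [Phi' [hL1 [hL2 [N1 N2 N3 N4 N5]]]]]] :=
  normalization_exists eP M0 L10 H1 Mid.
exists hM; split; first by exists Phi, Phi', hL1, hL2.
move=> hM' [Phi2 [Phi2' [hL1' [hL2' [N1' N2' N3' N4' N5']]]]].
have [QV nz1 _ cq _] := N1.
have [QV' _ _ cq' _] := N1'.
have eq1 : fmcomp (wform (inv_pair M) id) Phi = fmcomp Phi (wform (inv_pair hM) id).
  apply: Hol_inj; rewrite -!hol_comp.
  apply/(conjugateP QV (fixes0_wform _ _ : sfix (Hol _)) (fixes0_wform _ _ : sfix (Hol _))).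
  by rewrite cq sigma_formE.
have eq2 : fmcomp (wform (inv_pair M) id) Phi2 = fmcomp Phi2 (wform (inv_pair hM') id).
  apply: Hol_inj; rewrite -!hol_comp.
  apply/(conjugateP QV' (fixes0_wform _ _ : sfix (Hol _)) (fixes0_wform _ _ : sfix (Hol _))).
  by rewrite cq' sigma_formE.
have eq0 : fmcomp sigma Psi = fmcomp Psi (wform (inv_pair M) id).
  apply: Hol_inj; rewrite -!hol_comp.
  apply: (iffLR (conjugateP PV (s0 : sfix (Hol sigma))
    (fixes0_wform (inv_pair M) id : sfix (Hol (wform (inv_pair M) id))))).
  by rewrite cs sigma_formE.
have mu0 := mu_neq0 eP hlam.
(* [M(0)] may list the eigenvalues differently from [mu], so nonresonance is transported along the
   permutation that relates the two spectra. *)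
have nrM : pair_nonresonant (spectrum (fun j => M j 0%MM)).
  have lM : linear_part (wform (inv_pair M) id) (spectrum (fun j => M j 0%MM)).
    rewrite (_ : spectrum _ = fun i => inv_pair M i 0%MM); first exact: linear_part_wform.
    apply: funext; apply: xi_eta_ind => j; rewrite ?spectrum_l ?spectrum_r ?inv_pair_l ?inv_pair_r //.
    by rewrite fpsinv0.
  have [s sI sP] := conjugate_spectrum PV ls lM eq0.
  by apply: (pair_nonresonant_perm sI sP); [exact: spectrum_swap|exact: spectrum_swap|exact: nonresonant_pair].
have hM0 j : hM j 0%MM != 0 by rewrite N2.
have [Q0 Q0' QQ' Q'Q] := (iffLR (formal_inverseE _ _) QV).
have [P0 P0' PP' P'P] := (iffLR (formal_inverseE _ _) QV').
(* [Phi^-1 Phi2] carries one candidate normal form to the other. *)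
have FV : formal_inverse (fmcomp Phi' Phi2) (fmcomp Phi2' Phi).
  exact: (formal_inverse_comp (formal_inverse_sym QV) QV').
apply: (normalization_unique hM0 _ _ FV _ N4 N4' N5 N5').
- by move=> j; rewrite N2 N2'.
- rewrite (_ : (fun j => hM j 0%MM) = (fun j => M j 0%MM)) //.
  by apply: funext.
have e : fmcomp (wform (inv_pair hM) id) Phi' = fmcomp Phi' (wform (inv_pair M) id).
  have -> : wform (inv_pair hM) id = fmcomp Phi' (fmcomp (wform (inv_pair M) id) Phi).
    by rewrite eq1 -fmcompA // Q'Q fmcomp1f.
  rewrite [LHS]fmcompA //; last exact: fixes0_comp.
  by rewrite [fmcomp (fmcomp _ Phi) _]fmcompA // QQ' fmcompf1.
by rewrite -fmcompA // e !fmcompA // eq2.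
Qed.
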